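(* Let $\Phi$ be a $\mathbf{\Phi}$-function such that $\Phi\in(\mathrm{Dec})$. There exists a constant $C_\Phi>0$, depending only on $\Phi$, such that for every compact $\Omega\subset\mathbb{R}^d$ and Borel probability measure $\mu$ on $\Omega$, for every $N\ge1$, $H\ge1$, for every $N$-dimensional subspace $X_N\subset C(\Omega)$ with $X_N\in NI_{2,\infty}(H)$, and for every $\varepsilon\in(0,1/2]$, there are $m$ points $x_1,\dots,x_m\in\Omega$ with $$m\le C_\Phi\,\varepsilon^{-2}(\log\varepsilon^{-1})\,\Phi(H^2)(\log2N)^2\log2H^2$$ such that $$a_\Phi(1)^{-2}(1-\varepsilon)\|f\|_\Phi\le\|f\|_{\Phi,\mathbf{x}}\le a_\Phi(1)^2(1+\varepsilon)\|f\|_\Phi\quad\forall f\in X_N.$$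
   Context: $\log$ is the logarithm to base 2. ''Increasing'' and ''decreasing'' are non-strict. A $\mathbf{\Phi}$-function is an increasing $\Phi:[0,\infty)\to[0,\infty)$ with $\Phi(0)=0$, $\lim_{t\to0+}\Phi(t)=0$, $\lim_{t\to\infty}\Phi(t)=\infty$ such that $t\mapsto\Phi(t)t^{-1}$ is almost increasing on $(0,\infty)$: there is a constant $a_\Phi(1)\ge1$ with $\Phi(s)s^{-1}\le a_\Phi(1)\Phi(t)t^{-1}$ for all $0<s<t$. $\Phi\in(\mathrm{Dec})$ means that there is $q\ge1$ such that $t\mapsto\Phi(t)t^{-q}$ is decreasing on $(0,\infty)$. $C(\Omega)$ is the space of continuous (real- or complex-valued) functions on $\Omega$. $X_N\in NI_{2,\infty}(H)$ means $\max_{x\in\Omega}|f(x)|\le H(\int_\Omega|f|^2d\mu)^{1/2}$ for all $f\in X_N$. For a probability measure $\nu$, $\|f\|_{L^\Phi(\nu)}:=\inf\{\lambda>0:\int\Phi(|f|/\lambda)\,d\nu\le1\}$; $\|f\|_\Phi:=\|f\|_{L^\Phi(\mu)}$ and $\|f\|_{\Phi,\mathbf{x}}:=\|f\|_{L^\Phi(\nu)}$ with $\nu=\frac1m\sum_{j=1}^m\delta_{x_j}$, where the points $x_j$ need not be distinct. *)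

(* Defs.v *)
From HB Require Import structures.
From mathcomp Require Import all_boot all_order all_algebra.
From mathcomp Require Import all_classical all_reals all_analysis.
From mathcomp Require Import complex.

Set Implicit Arguments.
Unset Strict Implicit.
Unset Printing Implicit Defensive.

Import Order.TTheory GRing.Theory Num.Theory.
Import numFieldNormedType.Exports.

Local Open Scope classical_set_scope.
Local Open Scope ring_scope.

Definition log2 {R : realType} (x : R) : R := ln x / ln 2.

(* A function [0, oo) -> [0, oo) is represented by [Phi : R -> R], of which
   only the values on [0, oo) are ever constrained or used. *)

(* [a] is an admissible value of the constant a_Phi(1). *)
Definition almost_increasing_const {R : realType} (Phi : R -> R) (a : R) :
    Prop :=
  1 <= a /\ forall s t : R, 0 < s -> s < t -> Phi s / s <= a * (Phi t / t).

Record Phi_function {R : realType} (Phi : R -> R) : Prop := {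
  Phi_ge0 : forall t : R, 0 <= t -> 0 <= Phi t ;
  Phi_increasing : forall s t : R, 0 <= s -> s <= t -> Phi s <= Phi t ;
  Phi_at0 : Phi 0 = 0 ;
  Phi_cvg0 : Phi t @[t --> 0^'+] --> 0 ;
  Phi_cvgy : Phi t @[t --> +oo] --> +oo ;
  Phi_almost_increasing : exists a, almost_increasing_const Phi a }.

Definition Phi_Dec {R : realType} (Phi : R -> R) : Prop :=
  exists q : R, 1 <= q /\
    forall s t : R, 0 < s -> s <= t -> Phi t * t `^ (- q) <= Phi s * s `^ (- q).

(* The norm of L^Phi(nu), for a measure nu carried by D; it depends on a real
   or complex function f only through g = |f|. *)
Definition luxemburg_norm {dT : measure_display} {T : measurableType dT}
    {R : realType} (Phi : R -> R) (nu : {measure set T -> \bar R})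
    (D : set T) (g : T -> R) : R :=
  inf [set l : R | 0 < l /\
         (\int[nu]_(x in D) (Phi (g x / l))%:E <= 1)%E].

(* R^d with its Borel sigma-algebra. *)
Notation borel_space R d := (g_sigma_algebraType (@open 'rV[R]_d)).

(* (1/m) (delta_{x_0} + ... + delta_{x_{m-1}}); the points may repeat. *)
Definition empirical_measure {R : realType} {d : nat} (m : nat)
    (x : nat -> borel_space R d) : {measure set (borel_space R d) -> \bar R} :=
  mscale (m%:R^-1)%:nng (msum (fun j => \d_(x j)) m).

(* K is R or C, and nrm is its modulus, valued in R. A numFieldType carries the
   metric topology of its norm, which for these two is the usual one. *)
Variant scalar_field {R : realType} :
    forall K : numFieldType, (K -> R) -> Prop :=
| real_scalars : @scalar_field R R (fun x : R => `|x|)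
| complex_scalars : @scalar_field R R[i] (@ComplexField.Normc.normc R).

(* An element of C(Omega) is represented by any function on R^d whose
   restriction to Omega is that element, so continuity, linear independence
   and spanning all concern restrictions to Omega. *)
Record subspace_of_C {R : realType} {d : nat} {K : numFieldType}
    (Omega : set 'rV[R]_d) (N : nat) (X : set ('rV[R]_d -> K)) : Prop := {
  subspace_continuous : forall f, X f -> {within Omega, continuous f} ;
  subspace0 : X (fun=> 0) ;
  subspace_linear : forall (a : K) f g, X f -> X g ->
    X (fun x => a * f x + g x) ;
  subspace_basis : exists b : 'I_N -> 'rV[R]_d -> K,
    [/\ forall i, X (b i),
        forall c : 'I_N -> K,
          (forall x, Omega x -> \sum_(i < N) c i * b i x = 0) ->
          forall i, c i = 0
      & forall f, X f -> exists c : 'I_N -> K,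
          forall x, Omega x -> f x = \sum_(i < N) c i * b i x] }.

(* X \in NI_{2,oo}(H) *)
Definition nikolskii_2oo {R : realType} {d : nat} {K : numFieldType}
    (nrm : K -> R) (Omega : set 'rV[R]_d)
    (mu : {measure set (borel_space R d) -> \bar R})
    (X : set ('rV[R]_d -> K)) (H : R) : Prop :=
  forall f, X f -> forall x, Omega x ->
    nrm (f x) <= H * Num.sqrt (\int[mu]_(y in Omega) (nrm (f y) ^+ 2)).

(* Main.v *)
Require Import Defs.
From mathcomp Require Import all_boot all_order all_algebra.
From mathcomp Require Import all_classical all_reals all_analysis.
From mathcomp Require Import measurable_realfun.
From mathcomp Require Import complex.
From mathcomp Require Import ring lra.

Set Implicit Arguments.
Unset Strict Implicit.
Unset Printing Implicit Defensive.

Import Order.TTheory GRing.Theory Num.Theory.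
Import numFieldNormedType.Exports.

Local Open Scope classical_set_scope.
Local Open Scope ring_scope.

(** Sampling discretization by chaining.

    Functions are described by n real coordinates, n = N or 2 N, orthonormal
    for the L^2 norm (real_model, orthonormal_model). Let F be the set of
    the f in X with mean of Phi(|f|) at most 1. As both norms are
    homogeneous and Phi(t) / t is almost increasing, it suffices to find
    points for which the average of Phi(|f|) differs from its mean by at
    most eps, for all f in F at once (luxemburg_compare).

    On F the linear growth of Phi bounds the L^1 norm by a constant K; with
    the Nikolskii inequality the L^2 norm is at most H K and the sup norm at
    most B = H^2 K. By (Dec), Phi is Lipschitz on [0, B] with a constant Lam
    such that Lam * B is of the order of Phi(H^2). If |f - g| <= d
    pointwise, then Phi(|f|) - Phi(|g|) is therefore bounded by Lam d, and
    its variance is also of the order of Lam d, because Phi(|f|) and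
    Phi(|g|) have bounded means. Bernstein's inequality makes such a link
    cheap: m points control exp(X) links of radius d up to an error eta as
    soon as m eta^2 exceeds a multiple of Lam d X (chaining).

    The nets have radii B / 2^j. On a finite set of M points, a family in F
    that is d-separated in the sup norm has at most exp(C (H^2 / d) ln M)
    elements (sample_entropy), so that Lam d X does not depend on d: each
    scale asks for the same number of points, about Phi(H^2) ln M / eta^2.
    When B / 2^j reaches B / n, a single link to a grid net, of size exp(n
    L) with L logarithmic, finishes the chain. There are thus about log (2N)
    scales, each allowed the error eta = eps / log (2N); this accounts for
    the factor log (2N)^2. The factor ln M asks for a preliminary sample
    whose size M is polynomial in H and 1 / eps (crude_sample); the final
    points are chosen among its points (orlicz_sampling).

    The entropy estimate combines two facts. First, |f - g|^2 <= d (|f| +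
    |g|), so that around each member of F a ball of radius d for the sup
    norm meets F inside an L^2 ball of radius of order sqrt d. Secondly, a
    family in an L^2 ball that is separated at M points is small; this is
    the dual Sudakov inequality, obtained here by counting sign patterns
    (dual_sudakov). The points themselves are chosen one after the other so
    as to keep a sum of exponentials below 1, which replaces independent
    random points (select_points). *)

(** * Mean values and the selection of points *)

(** Follows from exp (- x) >= 1 - x alone: (1 + x + 2 x^2) (1 - x) >= 1 exactly
    when x <= 1/2, negative x included. *)
Lemma expR_le_quadratic {R : realType} (x : R) :
  x <= 1 / 2 -> expR x <= 1 + x + 2 * x ^+ 2.
Proof.
move=> hx.
have h1 : 1 - x <= expR (- x) by exact: expR_ge1Dx.
have hp : 0 < expR x := expR_gt0 x.
have h2 : expR x * (1 - x) <= 1.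
  have := expRxMexpNx_1 x.
  have : expR x * (1 - x) <= expR x * expR (- x) by rewrite ler_wpM2l // ltW.
  lra.
have h3 : 1 <= (1 + x + 2 * x ^+ 2) * (1 - x).
  rewrite -subr_ge0.
  have -> : (1 + x + 2 * x ^+ 2) * (1 - x) - 1 = x ^+ 2 * (1 - 2 * x) by ring.
  by rewrite mulr_ge0 ?sqr_ge0 //; lra.
have h4 : expR x * (1 - x) <= (1 + x + 2 * x ^+ 2) * (1 - x) by lra.
by rewrite ler_pM2r in h4; lra.
Qed.

Definition avg {R : realType} {T : Type} (m : nat) (x : nat -> T)
  (h : T -> R) : R := m%:R^-1 * \sum_(j < m) h (x j).

(** What the selection of points asks of a mean value. The two instances are the
    integral over Omega, on the functions continuous on Omega, and the average
    over a finite sample, on all functions. *)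
Record expectation {R : realType} {T : Type} (D : set T)
    (cls : set (T -> R)) (E : (T -> R) -> R) : Prop := {
  cls_cst : forall a, cls (fun=> a) ;
  clsD : forall f g, cls f -> cls g -> cls (fun x => f x + g x) ;
  clsM : forall f g, cls f -> cls g -> cls (fun x => f x * g x) ;
  cls_exp : forall f, cls f -> cls (fun x => expR (f x)) ;
  expect_cst : forall a, E (fun=> a) = a ;
  expectD : forall f g, cls f -> cls g ->
    E (fun x => f x + g x) = E f + E g ;
  expectZ : forall a f, cls f -> E (fun x => a * f x) = a * E f ;
  expect_le : forall f g, cls f -> cls g ->
    (forall x, D x -> f x <= g x) -> E f <= E g }.

Section Expectation.
Context {R : realType} {T : Type} {D : set T} {cls : set (T -> R)}
  {E : (T -> R) -> R} (hE : expectation D cls E).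

Lemma clsZ a f : cls f -> cls (fun x => a * f x).
Proof. by move=> cf; apply: (clsM hE) => //; exact: cls_cst hE _. Qed.

Lemma clsB f g : cls f -> cls g -> cls (fun x => f x - g x).
Proof.
move=> cf cg; have -> : (fun x => f x - g x) = (fun x => f x + (-1) * g x).
  by apply/funext => x; rewrite mulN1r.
by apply: (clsD hE) => //; apply: clsZ.
Qed.

Lemma expectB f g : cls f -> cls g -> E (fun x => f x - g x) = E f - E g.
Proof.
move=> cf cg; have -> : (fun x => f x - g x) = (fun x => f x + (-1) * g x).
  by apply/funext => x; rewrite mulN1r.
by rewrite (expectD hE) ?(expectZ hE) ?mulN1r //; apply: clsZ.
Qed.

Lemma cls_sum (I : Type) (s : seq I) (F : I -> T -> R) :
  (forall i, cls (F i)) -> cls (fun x => \sum_(i <- s) F i x).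
Proof.
move=> cF; elim: s => [|i s ih].
  under eq_fun do rewrite big_nil.
  exact: cls_cst hE _.
under eq_fun do rewrite big_cons.
exact: (clsD hE).
Qed.

Lemma expect_sum (I : Type) (s : seq I) (F : I -> T -> R) :
  (forall i, cls (F i)) ->
  E (fun x => \sum_(i <- s) F i x) = \sum_(i <- s) E (F i).
Proof.
move=> cF; elim: s => [|i s ih].
  under eq_fun do rewrite big_nil.
  by rewrite big_nil (expect_cst hE).
under eq_fun do rewrite big_cons.
by rewrite big_cons (expectD hE) ?ih //; exact: cls_sum.
Qed.

Lemma expect_lt_exists f : cls f -> E f < 1 -> exists2 x, D x & f x < 1.
Proof.
move=> cf; apply: contraPP => hn; apply/negP; rewrite -leNgt.
rewrite -(expect_cst hE 1); apply: (expect_le hE) => //.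
  exact: cls_cst hE _.
move=> x Dx; rewrite leNgt; apply/negP => fx; apply: hn; by exists x.
Qed.

(** Bernstein's bound on an exponential moment: as l * psi <= 1/2, the exponential
    is below its quadratic majorant, whose linear term has mean 0. *)
Lemma expect_exp_le (psi : T -> R) (b v l : R) :
  cls psi -> E psi = 0 -> (forall x, D x -> `|psi x| <= b) ->
  E (fun x => psi x ^+ 2) <= v -> 0 <= l -> l * b <= 1 / 2 ->
  E (fun x => expR (l * psi x)) <= expR (2 * l ^+ 2 * v).
Proof.
move=> cpsi E0 hb hv l0 lb.
have csq : cls (fun x => psi x ^+ 2).
  by under eq_fun do rewrite expr2; apply: (clsM hE).
have c1 : cls (fun x => l * psi x) by apply: clsZ.
have c2 : cls (fun x => 2 * l ^+ 2 * psi x ^+ 2) by apply: clsZ.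
have cc := cls_cst hE (1 : R).
have c3 : cls (fun x => 1 + l * psi x) by apply: (clsD hE).
apply: (@le_trans _ _ (E (fun x => (1 + l * psi x) + 2 * l ^+ 2 * psi x ^+ 2))).
  apply: (expect_le hE).
  - exact: (cls_exp hE).
  - exact: (clsD hE).
  - move=> x Dx.
    have := @expR_le_quadratic R (l * psi x); rewrite exprMn mulrA; apply.
    apply: le_trans lb; rewrite ler_wpM2l //.
    by apply: le_trans (hb x Dx); exact: ler_norm.
rewrite (expectD hE) // (expectD hE) // !(expectZ hE) // (expect_cst hE) E0.
rewrite mulr0 addr0; apply: le_trans (expR_ge1Dx _).
by rewrite lerD2l ler_wpM2l // mulr_ge0 // sqr_ge0.
Qed.

(** The method of conditional expectations. The sum in which every factor still to
    be evaluated is replaced by the upper bound A i of its mean is below 1 at the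
    start; seen as a function of the next point its mean does not exceed its
    current value, so that some point keeps it below 1. *)
Lemma greedy_points (I : eqType) (s : seq I) (c A : I -> R) (g : I -> T -> R)
  (m : nat) :
  (forall i, 0 <= c i) -> (forall i, cls (g i)) ->
  (forall i x, 0 <= g i x) -> (forall i, 0 <= A i) ->
  {in s, forall i, E (g i) <= A i} ->
  \sum_(i <- s) c i * A i ^+ m < 1 ->
  exists x : nat -> T, (forall j, (j < m)%N -> D (x j)) /\
    \sum_(i <- s) c i * \prod_(j < m) g i (x j) < 1.
Proof.
elim: m c => [|m ih] c c0 cg g0 A0 hA hs.
  have : exists2 x, D x & (fun=> 0 : R) x < 1.
    by apply: expect_lt_exists; [exact: cls_cst hE _ | rewrite (expect_cst hE)].
  move=> [x0 _ _]; exists (fun=> x0); split => //.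
  by move: hs; under eq_bigr do rewrite expr0; under [in X in _ -> X]eq_bigr do rewrite big_ord0.
pose f x := \sum_(i <- s) (c i * A i ^+ m) * g i x.
have cf : cls f by apply: cls_sum => i; apply: clsZ.
have Ef : E f < 1.
  rewrite expect_sum; last by move=> i; apply: clsZ.
  apply: le_lt_trans hs; rewrite big_seq [leRHS]big_seq; apply: ler_sum => i si.
  rewrite (expectZ hE) // exprSr mulrA ler_wpM2l ?hA //.
  by rewrite mulr_ge0 // exprn_ge0.
have [x0 Dx0 fx0] := expect_lt_exists cf Ef.
have [||x [Dx hx]] := ih (fun i => c i * g i x0) _ cg g0 A0 hA.
- by move=> i; rewrite mulr_ge0.
- by under eq_bigr do rewrite mulrAC.
exists (fun j => if j is j'.+1 then x j' else x0); split.
  by case=> [_|j hj] //; apply: Dx.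
under eq_bigr do rewrite big_ord_recl mulrA.
exact: hx.
Qed.

(** The union bound for Bernstein's inequality. The greedy choice is made for the
    exponentials of the deviations, with both signs; a deviation beyond its
    threshold would already contribute a term at least 1 to their sum. *)
Lemma select_points (I : eqType) (s : seq I) (psi : I -> T -> R)
    (b v eta : I -> R) (m : nat) :
  (0 < m)%N ->
  (forall i, cls (psi i)) ->
  (forall i, 0 < v i) -> (forall i, 0 < eta i) ->
  {in s, forall i x, D x -> `|psi i x - E (psi i)| <= b i} ->
  {in s, forall i, E (fun x => (psi i x - E (psi i)) ^+ 2) <= v i} ->
  {in s, forall i, eta i * b i <= 2 * v i} ->
  \sum_(i <- s) 2 * expR (- (m%:R * eta i ^+ 2 / (8 * v i))) < 1 ->
  exists x : nat -> T, (forall j, (j < m)%N -> D (x j)) /\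
    {in s, forall i, `|avg m x (psi i) - E (psi i)| <= eta i}.
Proof.
move=> m0 cpsi v0 eta0 hb hv heb hs.
have mR : 0 < m%:R :> R by rewrite ltr0n.
(* The minimiser of the exponent 2 l^2 v - l eta. *)
pose l i := eta i / (4 * v i).
have l0 i : 0 < l i by rewrite divr_gt0 // mulr_gt0.
have lb i : i \in s -> l i * b i <= 1 / 2.
  by move=> si; rewrite /l mulrAC ler_pdivrMr ?mulr_gt0 //; have := heb i si; lra.
pose c i := expR (- (m%:R * (l i * eta i))).
pose A i := expR (2 * l i ^+ 2 * v i).
pose ce i x := psi i x - E (psi i).
have cce i : cls (ce i) by apply: clsB => //; exact: cls_cst hE _.
have Ece i : E (ce i) = 0.
  by rewrite /ce expectB ?(expect_cst hE) ?subrr //; exact: cls_cst hE _.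
have sgnE (sg : R) i : i \in s -> `|sg| = 1 ->
    E (fun x => expR (l i * (sg * ce i x))) <= A i.
  move=> si hsg; apply: (@expect_exp_le _ (b i)).
  - exact: clsZ.
  - by rewrite (expectZ hE) // Ece mulr0.
  - by move=> x Dx; rewrite normrM hsg mul1r; apply: hb.
  - under eq_fun do rewrite exprMn -(real_normK (num_real sg)) hsg expr1n mul1r.
    exact: hv.
  - exact: ltW.
  - exact: lb si.
pose s2 := [seq (i, true) | i <- s] ++ [seq (i, false) | i <- s].
pose sg (b : bool) : R := if b then 1 else -1.
have nsg b0 : `|sg b0| = 1 by case: b0; rewrite /sg ?normrN normr1.
pose g (k : I * bool) x := expR (l k.1 * (sg k.2 * ce k.1 x)).
have [||||||x [Dx hx]] := @greedy_points (I * bool)%type s2 (fun k => c k.1) (fun k => A k.1) g m.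
- by move=> i; exact: expR_ge0.
- by move=> i; apply: (cls_exp hE); apply: clsZ; apply: clsZ.
- by move=> i x; exact: expR_ge0.
- by move=> i; exact: expR_ge0.
- move=> [i b0]; rewrite mem_cat => /orP[] /mapP[j sj [-> ->]] /=;
    exact: sgnE.
- rewrite /s2 big_cat !big_map /= -mulr2n -mulr_natl mulr_sumr.
  apply: le_lt_trans hs; apply: ler_sum => i _.
  rewrite ler_wpM2l // /c /A -expRM_natl -expRD ler_expR /l.
  have := v0 i => vi; rewrite le_eqVlt; apply/orP; left; apply/eqP.
  by field; lra.
exists x; split => //.
have key i b0 : c i * \prod_(j < m) g (i, b0) (x j) =
   expR (m%:R * (l i) * (sg b0 * (avg m x (psi i) - E (psi i)) - eta i)).
  rewrite /c /g /= -expR_sum -expRD; congr expR.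
  rewrite -mulr_sumr -mulr_sumr /ce sumrB sumr_const card_ord /avg -mulr_natl.
  by field; lra.
move=> i si; rewrite leNgt; apply/negP => h.
have : 1 <= \sum_(k <- s2) c k.1 * \prod_(j < m) g k (x j); last by lra.
have e1 (z : R) : 0 <= z -> 1 <= expR z.
  by move=> z0; apply: le_trans (expR_ge1Dx _); lra.
have hz z : eta i < z -> 1 <= expR (m%:R * l i * (z - eta i)).
  move=> hz; apply: e1; apply: mulr_ge0; last by rewrite subr_ge0 ltW.
  exact: mulr_ge0 (ltW mR) (ltW (l0 i)).
have pos k : 0 <= c k.1 * \prod_(j < m) g k (x j).
  by rewrite mulr_ge0 ?expR_ge0 // prodr_ge0 // => ? _; exact: expR_ge0.
have one b0 : 1 <= c i * \prod_(j < m) g (i, b0) (x j) ->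
    1 <= \sum_(k <- s2) c k.1 * \prod_(j < m) g k (x j).
  have : (i, b0) \in s2.
    by rewrite mem_cat; case: b0; rewrite (map_f (fun i => (i, _)) si) ?orbT.
  move=> /perm_to_rem/(perm_big _)-> h1; rewrite big_cons /=.
  by rewrite (le_trans h1) // lerDl sumr_ge0.
move: h; rewrite lter_normr => /orP[h|h].
  by apply: (one true); rewrite key /sg mul1r hz.
by apply: (one false); rewrite key /sg mulN1r hz.
Qed.

End Expectation.

(** * The dual Sudakov inequality *)

Section SignEstimator.
Context {R : realType} (n nu : nat).
Local Notation signs := {ffun 'I_nu * 'I_n -> bool}.
Implicit Types (c k : 'rV[R]_n) (s : signs).

Definition pm1 (b : bool) : R := if b then 1 else -1.

(** The law of nu * n independent signs, of which those in column i have mean c_i: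
    the average of the nu rows is an unbiased estimate of c. *)
Definition biased c s : R := \prod_x ((1 + pm1 (s x) * c 0 x.2) / 2).

(** The error of the row average, tested against k. *)
Definition deviation c k s : R :=
  \sum_x (k 0 x.2 / nu%:R) * (pm1 (s x) - c 0 x.2).

Lemma sum_signs_prod (F : 'I_nu * 'I_n -> bool -> R) :
  \sum_(s : signs) \prod_x F x (s x) = \prod_x (F x true + F x false).
Proof.
rewrite -(bigA_distr_bigA F); apply: eq_bigr => x _.
by rewrite big_bool.
Qed.

Lemma sumsq_coord_le c (r : R) (i : 'I_n) : 0 <= r ->
  \sum_i c 0 i ^+ 2 <= r ^+ 2 -> `|c 0 i| <= r.
Proof.
move=> r0 hc; rewrite -(ger0_norm r0) -ler_sqr ?nnegrE // !real_normK ?num_real //.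
apply: le_trans hc; rewrite (bigD1 i) //= lerDl sumr_ge0 // => j _.
exact: sqr_ge0.
Qed.

Lemma biased_ge0 c s : \sum_i c 0 i ^+ 2 <= 1 -> 0 <= biased c s.
Proof.
move=> hc; apply: prodr_ge0 => x _.
have : `|c 0 x.2| <= 1 by apply: sumsq_coord_le; rewrite ?expr1n.
rewrite ler_norml => /andP[h1 h2].
by rewrite /pm1; case: (s x); lra.
Qed.

Lemma biased_sum1 c : \sum_(s : signs) biased c s = 1.
Proof.
rewrite /biased (sum_signs_prod (fun x b => (1 + pm1 b * c 0 x.2) / 2)).
by rewrite big1 // => x _; rewrite /pm1; field.
Qed.

(** Relative to the uniform law, the second moment of the density is the product
    of the 1 + c_i^2 over all signs. *)
Lemma biased_sumsq c : \sum_i c 0 i ^+ 2 <= 1 ->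
  \sum_(s : signs) biased c s ^+ 2 <= (2 ^+ (nu * n))^-1 * expR nu%:R.
Proof.
move=> hc; rewrite /biased.
under eq_bigr do rewrite -prodrXl.
rewrite (sum_signs_prod (fun x b => ((1 + pm1 b * c 0 x.2) / 2) ^+ 2)).
apply: (@le_trans _ _ (\prod_(x : 'I_nu * 'I_n) (2^-1 * expR (c 0 x.2 ^+ 2)))).
  apply: ler_prod => x _; rewrite addr_ge0 ?sqr_ge0 //=.
  have := expR_ge1Dx (c 0 x.2 ^+ 2); rewrite /pm1 => h.
  have -> : ((1 + 1 * c 0 x.2) / 2) ^+ 2 + ((1 + (-1) * c 0 x.2) / 2) ^+ 2
     = 2^-1 * (1 + c 0 x.2 ^+ 2) by field.
  by rewrite ler_pM2l.
rewrite big_split /= prodr_const card_prod !card_ord exprVn ler_pM2l; last first.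
  by rewrite invr_gt0 exprn_gt0.
rewrite -expR_sum ler_expR.
rewrite -(pair_bigA _ (fun (i : 'I_nu) (j : 'I_n) => c 0 j ^+ 2)) /=.
by rewrite sumr_const card_ord -[leLHS]mulr_natr ler_piMl.
Qed.

Lemma biased_exp_moment c (th : 'I_nu * 'I_n -> R) :
  \sum_i c 0 i ^+ 2 <= 1 -> (forall x, `|th x| <= 1 / 4) ->
  \sum_(s : signs) biased c s * expR (\sum_x th x * (pm1 (s x) - c 0 x.2))
    <= expR (2 * \sum_x th x ^+ 2).
Proof.
move=> hc hth; under eq_bigr do rewrite expR_sum -big_split /=.
rewrite (sum_signs_prod (fun x b => (1 + pm1 b * c 0 x.2) / 2 *
    expR (th x * (pm1 b - c 0 x.2)))).
rewrite mulr_sumr expR_sum; apply: ler_prod => x _.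
have : `|c 0 x.2| <= 1 by apply: sumsq_coord_le; rewrite ?expr1n.
rewrite ler_norml => /andP[h1 h2].
have := hth x; rewrite ler_norml => /andP[h3 h4].
rewrite /pm1; set y := c 0 x.2 in h1 h2 *; set u := th x in h3 h4 *.
have e0 z : 0 <= expR z := expR_ge0 z.
have p1 : 0 <= (1 + 1 * y) / 2 by lra.
have p2 : 0 <= (1 + -1 * y) / 2 by lra.
apply/andP; split; first by apply: addr_ge0; apply: mulr_ge0.
have b1 : u * (1 - y) <= 1 / 2 by nra.
have b2 : u * (-1 - y) <= 1 / 2 by nra.
have := expR_le_quadratic b1; have := expR_le_quadratic b2.
set e1 := expR _; set e2 := expR _ => q2 q1.
apply: le_trans (expR_ge1Dx _).
have k1 : (1 + 1 * y) / 2 * e2 <=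
    (1 + 1 * y) / 2 * (1 + u * (1 - y) + 2 * (u * (1 - y)) ^+ 2).
  exact: ler_wpM2l.
have k2 : (1 + -1 * y) / 2 * e1 <=
    (1 + -1 * y) / 2 * (1 + u * (-1 - y) + 2 * (u * (-1 - y)) ^+ 2).
  exact: ler_wpM2l.
apply: le_trans (lerD k1 k2) _.
rewrite -subr_ge0.
have -> : 1 + 2 * u ^+ 2 -
  ((1 + 1 * y) / 2 * (1 + u * (1 - y) + 2 * (u * (1 - y)) ^+ 2) +
   (1 + -1 * y) / 2 * (1 + u * (-1 - y) + 2 * (u * (-1 - y)) ^+ 2))
  = 2 * (u * y) ^+ 2 by field.
by rewrite mulr_ge0 ?sqr_ge0.
Qed.

(** Chernoff's bound with parameter nu t / (8 h^2); the condition t <= 2 h keeps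
    every exponent below 1/2, where the quadratic bound on exp applies. *)
Lemma biased_tail c k (h t : R) :
  0 < h -> 0 < t -> t <= 2 * h -> (0 < nu)%N ->
  \sum_i c 0 i ^+ 2 <= 1 -> \sum_i k 0 i ^+ 2 <= h ^+ 2 ->
  \sum_(s : signs) biased c s * (t / 2 < deviation c k s)%R%:R
    <= expR (- (nu%:R * t ^+ 2 / (32 * h ^+ 2))).
Proof.
move=> h0 t0 th nu0 hc hk.
have nuR : 0 < nu%:R :> R by rewrite ltr0n.
pose l := nu%:R * t / (8 * h ^+ 2).
have l0 : 0 < l by rewrite /l divr_gt0 // mulr_gt0 // exprn_gt0.
apply: (@le_trans _ _ (expR (- (l * (t / 2))) *
   \sum_(s : signs) biased c s * expR (\sum_x (l * (k 0 x.2 / nu%:R)) * (pm1 (s x) - c 0 x.2)))).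
  rewrite mulr_sumr; apply: ler_sum => s _.
  have -> : \sum_x (l * (k 0 x.2 / nu%:R)) * (pm1 (s x) - c 0 x.2)
     = l * deviation c k s.
    by rewrite /deviation mulr_sumr; apply: eq_bigr => x _; rewrite !mulrA.
  rewrite mulrCA ler_wpM2l ?biased_ge0 // -expRD.
  case: ltP => hd; last exact: expR_ge0.
  apply: le_trans (expR_ge1Dx _); rewrite lerDl.
  have : 0 <= l * (deviation c k s - t / 2).
    by apply: mulr_ge0; rewrite ?subr_ge0 ltW.
  by rewrite mulrBr addrC.
apply: (@le_trans _ _ (expR (- (l * (t / 2))) *
   expR (2 * \sum_(x : 'I_nu * 'I_n) (l * (k 0 x.2 / nu%:R)) ^+ 2))).
  rewrite ler_wpM2l ?expR_ge0 //; apply: biased_exp_moment => // x.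
  have kx : `|k 0 x.2| <= h by apply: sumsq_coord_le; rewrite // ltW.
  have -> : l * (k 0 x.2 / nu%:R) = t / (8 * h ^+ 2) * k 0 x.2.
    by rewrite /l; field; lra.
  rewrite normrM (ger0_norm (x := t / _)); last first.
    by rewrite divr_ge0 ?mulr_ge0 ?sqr_ge0 // ltW.
  apply: (@le_trans _ _ (t / (8 * h ^+ 2) * h)).
    by rewrite ler_wpM2l // divr_ge0 ?mulr_ge0 ?sqr_ge0 // ltW.
  have -> : t / (8 * h ^+ 2) * h = t / (8 * h) by field; lra.
  by rewrite ler_pdivrMr ?mulr_gt0 //; lra.
rewrite -expRD ler_expR.
have -> : \sum_(x : 'I_nu * 'I_n) (l * (k 0 x.2 / nu%:R)) ^+ 2
   = nu%:R * (t / (8 * h ^+ 2)) ^+ 2 * \sum_i k 0 i ^+ 2.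
  rewrite -(pair_bigA _ (fun (i : 'I_nu) (j : 'I_n) => (l * (k 0 j / nu%:R)) ^+ 2)) /=.
  rewrite sumr_const card_ord -[LHS]mulr_natl -[RHS]mulrA; congr (_ * _).
  rewrite mulr_sumr; apply: eq_bigr => i _; rewrite /l; field; lra.
have hb : nu%:R * (t / (8 * h ^+ 2)) ^+ 2 * (\sum_i k 0 i ^+ 2) <=
    nu%:R * (t / (8 * h ^+ 2)) ^+ 2 * h ^+ 2.
  by rewrite ler_wpM2l // mulr_ge0 ?sqr_ge0.
have e1 : nu%:R * (t / (8 * h ^+ 2)) ^+ 2 * h ^+ 2 = nu%:R * t ^+ 2 / (32 * h ^+ 2) / 2.
  by field; lra.
have e2 : l * (t / 2) = nu%:R * t ^+ 2 / (32 * h ^+ 2) * 2.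
  by rewrite /l; field; lra.
by rewrite e2; lra.
Qed.

(** Under the law with means c, the patterns good for all functionals have mass at
    least 1/2, by the tail bound. As the second moment of that law relative to the
    uniform one is at most e^nu, they are a fraction at least e^(-nu) / 4 of all
    patterns. *)
Lemma good_signs_card (I : finType) (k : I -> 'rV[R]_n) c (h t : R) :
  0 < h -> 0 < t -> t <= 2 * h -> (0 < nu)%N ->
  (forall i, \sum_j k i 0 j ^+ 2 <= h ^+ 2) -> \sum_i c 0 i ^+ 2 <= 1 ->
  32 * h ^+ 2 * ln (4 * #|I|%:R) <= nu%:R * t ^+ 2 ->
  (2 : R) ^+ (nu * n) <= 4 * expR nu%:R *
    \sum_(s : signs) ([forall i, `|deviation c (k i) s| <= t / 2]%R)%:R.
Proof.
move=> h0 t0 th nu0 hk hc hnu.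
set good := fun s => [forall i, `|deviation c (k i) s| <= t / 2].
set z := \sum_(s : signs) _.
have devN k' s : deviation c (- k') s = - deviation c k' s.
  by rewrite /deviation -sumrN; apply: eq_bigr => x _; rewrite mxE mulNr mulNr.
have tail i : \sum_(s : signs) biased c s * (t / 2 < `|deviation c (k i) s|)%R%:R
    <= 2 * expR (- (nu%:R * t ^+ 2 / (32 * h ^+ 2))).
  have t1 := biased_tail h0 t0 th nu0 hc (hk i).
  have hkN : \sum_j (- k i) 0 j ^+ 2 <= h ^+ 2.
    by under eq_bigr do rewrite mxE sqrrN.
  have t2 := biased_tail h0 t0 th nu0 hc hkN.
  apply: (@le_trans _ _ (\sum_(s : signs) biased c s * (t / 2 < deviation c (k i) s)%R%:R +
     \sum_(s : signs) biased c s * (t / 2 < deviation c (- k i) s)%R%:R)); last by lra.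
  rewrite -big_split /=; apply: ler_sum => s _; rewrite -mulrDr.
  rewrite ler_wpM2l ?biased_ge0 // devN lter_normr -natrD ler_nat.
  by case: (_ < _); case: (_ < _).
have half : 1 / 2 <= \sum_(s : signs) biased c s * (good s)%:R.
  have hI : \sum_(i : I) 2 * expR (- (nu%:R * t ^+ 2 / (32 * h ^+ 2))) <= 1 / 2.
    rewrite sumr_const -[leLHS]mulr_natl; case: (posnP #|I|) => [->|I0].
      by rewrite mul0r; lra.
    have I0R : 0 < #|I|%:R :> R by rewrite ltr0n.
    have : expR (- (nu%:R * t ^+ 2 / (32 * h ^+ 2))) <= (4 * #|I|%:R)^-1.
      rewrite -[leRHS]lnK ?posrE ?invr_gt0 ?mulr_gt0 // ler_expR lnV ?posrE ?mulr_gt0 //.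
      by rewrite lerN2 ler_pdivlMr ?mulr_gt0 ?exprn_gt0 // mulrC.
    move=> he; apply: (@le_trans _ _ (#|I|%:R * (2 * (4 * #|I|%:R)^-1))).
      by rewrite ler_pM2l // ler_pM2l.
    by rewrite le_eqVlt; apply/orP; left; apply/eqP; field; lra.
  have : 1 <= \sum_(s : signs) biased c s * (good s)%:R +
     \sum_i \sum_(s : signs) biased c s * (t / 2 < `|deviation c (k i) s|)%R%:R.
    rewrite exchange_big /= -[leLHS](biased_sum1 c) -big_split /=.
    apply: ler_sum => s _; rewrite -mulr_sumr -mulrDr -[leLHS]mulr1.
    rewrite ler_wpM2l ?biased_ge0 // /good.
    case: (boolP [forall i, _]) => [_|].
      by rewrite /= mulr1n lerDl sumr_ge0.
    case/forallPn => i; rewrite -ltNge => hi.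
    by rewrite /= mulr0n add0r (bigD1 i) //= hi mulr1n lerDl sumr_ge0.
  have : \sum_i \sum_(s : signs) biased c s * (t / 2 < `|deviation c (k i) s|)%R%:R
      <= \sum_(i : I) 2 * expR (- (nu%:R * t ^+ 2 / (32 * h ^+ 2))).
    by apply: ler_sum => i _; exact: tail.
  lra.
have W := biased_sumsq hc.
set Wr := (2 ^+ (nu * n))^-1 * expR nu%:R in W *.
have W0 : 0 < Wr by rewrite mulr_gt0 ?expR_gt0 // invr_gt0 exprn_gt0.
(* Cauchy-Schwarz, with the optimal constant of b <= b^2 / (2 s) + s / 2 put in:
   summed over the good patterns, the square term is at most 1/4. *)
have pt s : biased c s * (good s)%:R <= biased c s ^+ 2 / (4 * Wr) + Wr * (good s)%:R.
  have W4 : 0 < 4 * Wr by rewrite mulr_gt0.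
  case: (good s); rewrite ?mulr1 ?mulr0 ?addr0; last by rewrite divr_ge0 ?sqr_ge0 // ltW.
  rewrite -subr_ge0.
  have -> : biased c s ^+ 2 / (4 * Wr) + Wr - biased c s
    = (biased c s - 2 * Wr) ^+ 2 / (4 * Wr) by field; lra.
  by rewrite divr_ge0 ?sqr_ge0 // ltW.
have : 1 / 2 <= 1 / 4 + Wr * z.
  apply: le_trans half _; apply: le_trans (ler_sum _ (fun s _ => pt s)) _.
  rewrite big_split /= -mulr_suml -mulr_sumr lerD2r ler_pdivrMr ?mulr_gt0 //.
  by apply: le_trans W _; lra.
move=> hz; have {hz} : 1 <= 4 * (Wr * z) by lra.
rewrite /Wr -(ler_pM2l (_ : 0 < 2 ^+ (nu * n) :> R)) ?exprn_gt0 // mulr1.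
move=> /le_trans; apply; rewrite le_eqVlt; apply/orP; left; apply/eqP.
have : 2 ^+ (nu * n) != 0 :> R by rewrite expf_neq0.
by move=> ?; field.
Qed.

End SignEstimator.

Lemma count_pairwise_le1 (T : Type) (r : rel T) (P : pred T) (s : seq T) :
  pairwise r s -> (forall x y, P x -> P y -> ~~ r x y) -> (count P s <= 1)%N.
Proof.
move=> + hP; elim: s => //= x s ih /andP[rx ps].
have := ih ps; case: (boolP (P x)) => //= Px _; rewrite add1n ltnS leqn0.
move: rx; rewrite -[count _ _ == 0%N]negbK -lt0n -has_count => rx.
by rewrite -all_predC; apply: sub_all rx => y; apply: contraTN => Py; exact: hP.
Qed.

(** Dual Sudakov inequality. A sign pattern good for c and for c' estimates both by
    the same value, so that no functional separates c from c' by more than t. The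
    good patterns of the members of a separated family thus form disjoint sets,
    each of which is a fixed fraction of all patterns. *)
Lemma dual_sudakov_unit {R : realType} (n nu : nat) (I : finType)
    (k : I -> 'rV[R]_n) (h t : R) (s : seq 'rV[R]_n) :
  0 < h -> 0 < t -> t <= 2 * h -> (0 < nu)%N ->
  (forall i, \sum_j k i 0 j ^+ 2 <= h ^+ 2) ->
  {in s, forall c : 'rV[R]_n, \sum_i c 0 i ^+ 2 <= 1} ->
  pairwise (fun c c' : 'rV[R]_n => [exists i, t < `|\sum_j (c - c') 0 j * k i 0 j|]) s ->
  32 * h ^+ 2 * ln (4 * #|I|%:R) <= nu%:R * t ^+ 2 ->
  (size s)%:R <= 4 * expR nu%:R :> R.
Proof.
move=> h0 t0 th nu0 hk hs sep hnu.
have nuR : nu%:R != 0 :> R by rewrite pnatr_eq0 -lt0n.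
pose good c (e : {ffun 'I_nu * 'I_n -> bool}) :=
  [forall i, `|deviation c (k i) e| <= t / 2].
have tw : 0 < 2 ^+ (nu * n) :> R by rewrite exprn_gt0.
rewrite -(ler_pM2r tw).
apply: (@le_trans _ _ (\sum_(c <- s) 4 * expR nu%:R *
    \sum_(e : {ffun 'I_nu * 'I_n -> bool}) (good c e)%:R)).
  rewrite -sum1_size natr_sum mulr_suml big_seq [leRHS]big_seq.
  apply: ler_sum => c cs; rewrite mul1r.
  exact: (good_signs_card h0 t0 th nu0 hk (hs c cs) hnu).
rewrite -mulr_sumr ler_wpM2l ?mulr_ge0 ?expR_ge0 // exchange_big /=.
apply: (@le_trans _ _ (\sum_(e : {ffun 'I_nu * 'I_n -> bool}) 1)); last first.
  rewrite sumr_const card_ffun card_prod !card_ord card_bool.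
  by rewrite natrX.
apply: ler_sum => e _.
have -> : \sum_(c <- s) (good c e)%:R = (count (good^~ e) s)%:R :> R.
  by rewrite -sum1_count [in RHS]big_mkcond natr_sum; apply: eq_bigr => c _; case: (good c e).
rewrite lern1; apply: count_pairwise_le1 sep _ => c c' /forallP gc /forallP gc'.
rewrite negb_exists; apply/forallP => i; rewrite -leNgt.
have -> : \sum_j (c - c') 0 j * k i 0 j = deviation c' (k i) e - deviation c (k i) e.
  rewrite /deviation -sumrB.
  transitivity (\sum_(x : 'I_nu * 'I_n) (c - c') 0 x.2 * (k i 0 x.2 / nu%:R)).
    rewrite -(pair_bigA _ (fun (a : 'I_nu) (b : 'I_n) =>
       (c - c') 0 b * (k i 0 b / nu%:R))) /=.
    rewrite sumr_const card_ord -[RHS]mulr_natl mulr_sumr; apply: eq_bigr => j _.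
    by field.
  by apply: eq_bigr => x _; rewrite !mxE; ring.
apply: le_trans (ler_normB _ _) _; have := gc i; have := gc' i; lra.
Qed.

Lemma dual_sudakov {R : realType} (n nu : nat) (I : finType)
    (k : I -> 'rV[R]_n) (h t r : R) (c0 : 'rV[R]_n) (s : seq 'rV[R]_n) :
  0 < h -> 0 < t -> 0 < r -> t <= 2 * h * r -> (0 < nu)%N ->
  (forall i, \sum_j k i 0 j ^+ 2 <= h ^+ 2) ->
  {in s, forall c : 'rV[R]_n, \sum_i (c - c0) 0 i ^+ 2 <= r ^+ 2} ->
  pairwise (fun c c' : 'rV[R]_n => [exists i, t < `|\sum_j (c - c') 0 j * k i 0 j|]) s ->
  32 * h ^+ 2 * r ^+ 2 * ln (4 * #|I|%:R) <= nu%:R * t ^+ 2 ->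
  (size s)%:R <= 4 * expR nu%:R :> R.
Proof.
move=> h0 t0 r0 th nu0 hk hs sep hnu.
rewrite -(size_map (fun c => r^-1 *: (c - c0)) s).
apply: (@dual_sudakov_unit _ _ _ I k h (t / r)) => //.
- by rewrite divr_gt0.
- by rewrite ler_pdivrMr.
- move=> _ /mapP[c cs ->]; under eq_bigr do rewrite mxE exprMn.
  rewrite -mulr_sumr exprVn mulrC ler_pdivrMr ?exprn_gt0 // mul1r.
  exact: hs.
- rewrite pairwise_map; apply: sub_pairwise sep => c c' /existsP [i hi].
  apply/existsP; exists i => /=.
  have -> : \sum_j (r^-1 *: (c - c0) - r^-1 *: (c' - c0)) 0 j * k i 0 j
     = r^-1 * \sum_j (c - c') 0 j * k i 0 j.
    by rewrite mulr_sumr; apply: eq_bigr => j _; rewrite !mxE; ring.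
  by rewrite normrM gtr0_norm ?invr_gt0 // [ltRHS]mulrC ltr_pM2r ?invr_gt0.
- by rewrite expr_div_n [leRHS]mulrA ler_pdivlMr ?exprn_gt0 //; lra.
Qed.

(** * Separated families and nets *)

Section Packing.
Context {R : realType} {T : Type} (n : nat) (V : T -> 'rV[R]_n -> R)
  (D : set T).
Implicit Types (F : set 'rV[R]_n) (s : seq 'rV[R]_n) (c g : 'rV[R]_n).

Definition far (d : R) : rel 'rV[R]_n :=
  fun c c' => `[< exists2 y, D y & d < V y (c - c') >].

Definition packing_le F (d X : R) :=
  forall s, {in s, forall c, F c} -> pairwise (far d) s -> (size s)%:R <= X.

Lemma nfarP d c c' : ~~ far d c c' -> forall y, D y -> V y (c - c') <= d.
Proof. by move=> /asboolPn h y Dy; rewrite leNgt; apply/negP => ?; apply: h; exists y. Qed.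

(** A separated family of maximal size is a net. *)
Lemma net_of_packing F d X : packing_le F d X ->
  exists s, [/\ {in s, forall c, F c}, pairwise (far d) s, (size s)%:R <= X
    & forall c, F c -> exists2 g, g \in s & ~~ far d c g].
Proof.
move=> hX.
pose P k := `[< exists s, [/\ {in s, forall c, F c}, pairwise (far d) s & size s = k] >].
have P0 : exists k, P k by exists 0%N; apply/asboolP; exists [::].
have Pb k : P k -> (k <= Num.truncn X)%N.
  move=> /asboolP[s [Fs ps <-]]; have := hX s Fs ps.
  by rewrite truncn_ge_nat // (le_trans _ (hX s Fs ps)).
case: (ex_maxnP P0 Pb) => k /asboolP[s [Fs ps sk]] kmax.
exists s; split => //; first exact: hX.
move=> c Fc; apply: contrapT => hn.
have : P k.+1; last by move=> /kmax; rewrite ltnn.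
apply/asboolP; exists (c :: s); split => /=; last by rewrite sk.
  by move=> x; rewrite inE => /orP[/eqP->//|/Fs].
rewrite ps andbT; apply/allP => g gs.
by apply: contrapT => /negP hf; apply: hn; exists g.
Qed.

(** A net at radius 2 d splits a d-separated family into at most X1 parts, each
    contained in one ball. *)
Lemma packing_refine F (d X1 X2 : R) : 0 <= X2 ->
  packing_le F (2 * d) X1 ->
  (forall g, F g -> packing_le [set c | F c /\ ~~ far (2 * d) c g] d X2) ->
  packing_le F d (X1 * X2).
Proof.
move=> X20 h1 h2 s Fs ps.
have : packing_le [set` s] (2 * d) X1.
  by move=> s' ss'; apply: h1 => c /ss' /=; exact: Fs.
case/net_of_packing => s' [ss' _ hs' cov].
apply: (@le_trans _ _ (\sum_(g <- s') (count (fun c => ~~ far (2 * d) c g) s)%:R)).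
  under [leRHS]eq_bigr do rewrite -sum1_count big_mkcond natr_sum.
  rewrite exchange_big /= -sum1_size natr_sum big_seq [leRHS]big_seq.
  apply: ler_sum => c cs; have [g gs hg] := cov c cs.
  by rewrite (big_rem g) //= hg lerDl sumr_ge0.
apply: (@le_trans _ _ (\sum_(g <- s') X2)).
  rewrite big_seq [leRHS]big_seq; apply: ler_sum => g gs.
  rewrite -size_filter; apply: (h2 g (Fs _ (ss' _ gs))).
    by move=> c; rewrite mem_filter => /andP[hc cs]; split => //; exact: Fs.
  exact: pairwise_filter.
rewrite big_const_seq count_predT iter_addr_0 -[leLHS]mulr_natl.
by rewrite ler_wpM2r.
Qed.

(** The members of a separated family lie in different cells of a grid of mesh h. *)
Lemma packing_grid F (d r h : R) : 0 <= r -> 0 < h ->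
  (forall c, F c -> forall i, `|c 0 i| <= r) ->
  (forall c c', far d c c' -> exists i, h < `|(c - c') 0 i|) ->
  packing_le F d ((2 * r / h + 1) ^+ n).
Proof.
move=> r0 h0 hr hh s Fs ps.
pose cell c (i : 'I_n) := Num.truncn ((c 0 i + r) / h).
pose K := Num.truncn (2 * r / h).
have e0 : 0 <= 2 * r / h by rewrite divr_ge0 ?mulr_ge0 // ltW.
have c0 c i : F c -> 0 <= (c 0 i + r) / h.
  move=> /hr /(_ i); rewrite ler_norml => /andP[h1 _].
  by rewrite divr_ge0 ?(ltW h0) //; lra.
have cK c i : F c -> (cell c i <= K)%N.
  move=> Fc; apply: le_truncn; rewrite ler_pM2r ?invr_gt0 //.
  by have := hr _ Fc i; rewrite ler_norml => /andP[_]; lra.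
pose code c : {ffun 'I_n -> 'I_K.+1} := [ffun i => inord (cell c i)].
have codeinj c c' : F c -> F c' -> far d c c' -> code c != code c'.
  move=> Fc Fc' /hh; case=> i; apply: contraTN => /eqP /ffunP/(_ i).
  rewrite !ffunE => /(congr1 (@nat_of_ord _)); rewrite !inordK ?ltnS ?cK // => hcell.
  have /truncn_itv/andP[a1 a2] := c0 _ i Fc.
  have /truncn_itv/andP[b1 b2] := c0 _ i Fc'.
  rewrite -/(cell c i) -/(cell c' i) in a1 a2 b1 b2.
  rewrite -leNgt !mxE.
  have -> : c 0 i - c' 0 i = ((c 0 i + r) / h - (c' 0 i + r) / h) * h by field; lra.
  rewrite normrM (gtr0_norm h0) ler_piMl ?(ltW h0) //.
  rewrite hcell in a1 a2; rewrite -natr1 in a2 b2.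
  by rewrite ler_norml; apply/andP; split; lra.
have uq : uniq (map code s).
  rewrite uniq_pairwise pairwise_map.
  move: (ps) => /(sub_in_pairwise (P := mem s) _); apply; last by apply/allP.
  by move=> c c' /Fs Fc /Fs Fc'; exact: codeinj.
apply: (@le_trans _ _ (K.+1%:R ^+ n)).
  rewrite -natrX ler_nat -(size_map code) -(card_uniqP uq).
  by apply: leq_trans (max_card _) _; rewrite card_ffun !card_ord.
rewrite lerXn2r ?nnegrE ?ler0n //; first by lra.
by rewrite -natr1 lerD2r truncn_le.
Qed.

End Packing.

(** * Growth of Phi *)

(** The hypotheses on Phi with the exponent of (Dec) rounded up to an integer and
    the denominators cleared. *)
Record regular_growth {R : realType} (Phi : R -> R) (q : nat) (a : R) : Prop := {
  growth_ge0 : forall t, 0 <= t -> 0 <= Phi t ;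
  growth_mono : forall s t, 0 <= s -> s <= t -> Phi s <= Phi t ;
  growth_at0 : Phi 0 = 0 ;
  growth_gt0 : forall t, 0 < t -> 0 < Phi t ;
  growth_q : (0 < q)%N ;
  growth_ai : almost_increasing_const Phi a ;
  growth_dec : forall s t, 0 < s -> s <= t -> Phi t * s ^+ q <= Phi s * t ^+ q }.

(** Phi is positive on (0, oo): by (Dec) a zero would propagate to all larger
    arguments, and Phi could not tend to infinity. *)
Lemma regular_growth_of_Dec {R : realType} (Phi : R -> R) (a : R) :
  Phi_function Phi -> Phi_Dec Phi -> almost_increasing_const Phi a ->
  exists q, regular_growth Phi q a.
Proof.
move=> hPhi [q [q1 hq]] ha.
have dec (s t : R) : 0 < s -> s <= t ->
    Phi t * s `^ q <= Phi s * t `^ q.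
  move=> s0 st; have t0 : 0 < t by exact: lt_le_trans st.
  have := hq s t s0 st; rewrite !powRN => h.
  have sq : 0 < s `^ q by exact: powR_gt0.
  have tq : 0 < t `^ q by exact: powR_gt0.
  by move: h; rewrite ler_pdivrMr // mulrAC ler_pdivlMr.
exists (Num.truncn q).+1; split => //.
- exact: Phi_ge0 hPhi.
- exact: Phi_increasing hPhi.
- exact: Phi_at0 hPhi.
- move=> s s0; have := Phi_ge0 hPhi (ltW s0); rewrite le_eqVlt => /orP[/eqP e|//].
  have z t : s <= t -> Phi t <= 0.
    move=> st; have := dec s t s0 st; rewrite -e mul0r pmulr_lle0 //.
    exact: powR_gt0.
  have /cvgryPge/(_ 1) := Phi_cvgy hPhi.
  move=> hn.
  have : \forall t \near +oo, s <= t by apply: nbhs_pinfty_ge; exact: num_real.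
  move=> hs; have [t [t1 t2]] := filter_ex (filterI hn hs).
  have := z t t2; lra.
- move=> s t s0 st; have t0 : 0 < t by exact: lt_le_trans st.
  set Q := (Num.truncn q).+1.
  have hQ : 0 <= Q%:R - q by have := truncnS_gt q; rewrite -/Q; lra.
  have e (x : R) : 0 < x -> x ^+ Q = x `^ q * x `^ (Q%:R - q).
    move=> x0; rewrite -powR_mulrn ?ltW // -powRD; first by rewrite addrC subrK.
    by rewrite (gt_eqF x0) implybT.
  rewrite !e // !mulrA; apply: ler_pM => //.
  + by rewrite mulr_ge0 ?powR_ge0 // (Phi_ge0 hPhi) // ltW.
  + exact: powR_ge0.
  + exact: dec.
  + by rewrite ge0_ler_powR // nnegrE ltW.
Qed.

Lemma bernoulli_sub {R : realType} (x : R) (q : nat) : 0 <= x -> x <= 1 ->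
  1 - x ^+ q <= q%:R * (1 - x).
Proof.
move=> x0 x1; elim: q => [|q ih]; first by rewrite expr0 mul0r subrr.
rewrite exprS -natr1.
have xq0 : 0 <= x ^+ q by exact: exprn_ge0.
have : x ^+ q <= 1 by exact: exprn_ile1.
nra.
Qed.

Section Growth.
Context {R : realType} {Phi : R -> R} {q : nat} {a : R}
  (hP : regular_growth Phi q a).

Lemma growth_a1 : 1 <= a. Proof. by case: (growth_ai hP). Qed.

Lemma growth_ai_le s t : 0 < s -> s <= t -> Phi s / s <= a * (Phi t / t).
Proof.
move=> s0; rewrite le_eqVlt => /orP[/eqP <-|st].
  rewrite ler_peMl ?growth_a1 // divr_ge0 ?ltW //.
  exact: growth_gt0 hP _ _.
exact: (growth_ai hP).2.
Qed.

Definition growth_lip (B : R) := q%:R * a * (Phi B / B).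

Lemma growth_lip_gt0 B : 0 < B -> 0 < growth_lip B.
Proof.
move=> B0; rewrite /growth_lip mulr_gt0 //; last first.
  by rewrite divr_gt0 ?(growth_gt0 hP).
rewrite mulr_gt0 ?ltr0n ?(growth_q hP) //; exact: lt_le_trans growth_a1.
Qed.

(** By (Dec), Phi s >= Phi t * (s / t)^q; Bernoulli's inequality bounds
    1 - (s / t)^q by q (1 - s / t), and Phi t / t <= a * Phi B / B. *)
Lemma growth_lip_le B s t : 0 <= s -> s <= t -> t <= B -> 0 < B ->
  Phi t - Phi s <= growth_lip B * (t - s).
Proof.
move=> s0 st tB B0.
have [tz|t_neq] := eqVneq t 0; have [hs|s_neq] := eqVneq s 0.
- by rewrite hs tz !subrr mulr0.
- have sp : 0 < s by rewrite lt_def s_neq.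
  by move: st; rewrite tz leNgt sp.
- move: s0 st; rewrite {}hs => _ t0; have {}t0 : 0 < t by rewrite lt_def t_neq.
  rewrite (growth_at0 hP) !subr0 /growth_lip.
  have := growth_ai_le t0 tB; rewrite ler_pdivrMr // => h; apply: le_trans h _.
  rewrite ler_wpM2r ?(ltW t0) // -mulrA ler_peMl //.
    rewrite mulr_ge0 ?(le_trans ler01 growth_a1) //.
    by rewrite divr_ge0 ?(ltW B0) // ltW // (growth_gt0 hP).
  by rewrite ler1n (growth_q hP).
have sp : 0 < s by rewrite lt_def s_neq.
have t0 : 0 < t by exact: lt_le_trans st.
have d := growth_dec hP sp st.
have x1 : s / t <= 1 by rewrite ler_pdivrMr // mul1r.
have x0 : 0 <= s / t by rewrite divr_ge0 // ltW.
have b := bernoulli_sub q x0 x1.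
have Pt : 0 < Phi t by exact: growth_gt0 hP _ _.
have h1 : Phi t * (s / t) ^+ q <= Phi s.
  by rewrite expr_div_n mulrA ler_pdivrMr ?exprn_gt0.
have h2 : Phi t - Phi s <= Phi t * (q%:R * (1 - s / t)).
  have : Phi t * (1 - (s / t) ^+ q) <= Phi t * (q%:R * (1 - s / t)) by rewrite ler_pM2l.
  lra.
apply: le_trans h2 _.
have -> : Phi t * (q%:R * (1 - s / t)) = q%:R * (Phi t / t) * (t - s) by field.
rewrite ler_wpM2r ?subr_ge0 // /growth_lip -mulrA ler_wpM2l //.
exact: growth_ai_le.
Qed.

Lemma growth_lip_abs B s t : 0 <= s -> 0 <= t -> s <= B -> t <= B -> 0 < B ->
  `|Phi s - Phi t| <= growth_lip B * `|s - t|.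
Proof.
move=> s0 t0 sB tB B0; case: (leP s t) => st.
  rewrite distrC [X in _ * X]distrC !ger0_norm ?subr_ge0 //.
    exact: growth_lip_le.
  exact: growth_mono hP _ _ _ _.
have {}st := ltW st; rewrite !ger0_norm ?subr_ge0 //.
  exact: growth_lip_le.
exact: growth_mono hP _ _ _ _.
Qed.

(** Turns a bound on the mean of Phi(|f|) into a bound on the L^1 norm of f. *)
Lemma growth_ge_linear t : 0 <= t -> t <= 1 + a / Phi 1 * Phi t.
Proof.
move=> t0; have p1 := growth_gt0 hP ltr01.
have a1 := growth_a1.
have pos : 0 <= a / Phi 1 * Phi t.
  by rewrite mulr_ge0 ?(growth_ge0 hP) // divr_ge0 ?ltW //; lra.
case: (leP t 1) => t1; first by lra.
have := growth_ai_le ltr01 (ltW t1); rewrite divr1 mulrA ler_pdivlMr; last by lra.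
move=> h; have -> : a / Phi 1 * Phi t = a * Phi t / Phi 1 by rewrite mulrAC.
have : t <= a * Phi t / Phi 1 by rewrite ler_pdivlMr // mulrC.
lra.
Qed.

Lemma growth_dilate K u : 1 <= K -> 0 < u -> Phi (K * u) <= K ^+ q * Phi u.
Proof.
move=> K1 u0; have h : u <= K * u by rewrite ler_peMl // ltW.
have := growth_dec hP u0 h; rewrite exprMn [leRHS]mulrCA [leRHS]mulrA.
by rewrite ler_pM2r ?exprn_gt0.
Qed.

Lemma growth_shrink l t : 0 < l -> l <= 1 -> 0 <= t -> Phi (l * t) <= a * l * Phi t.
Proof.
move=> l0 l1; rewrite le_eqVlt => /orP[/eqP <-|t0].
  by rewrite mulr0 (growth_at0 hP) mulr0.
have lt0 : 0 < l * t by rewrite mulr_gt0.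
have h : l * t <= t by rewrite ler_piMl // ltW.
have := growth_ai_le lt0 h; rewrite ler_pdivrMr // => h'.
by apply: le_trans h' _; rewrite le_eqVlt; apply/orP; left; apply/eqP; field; lra.
Qed.

Lemma growth_shrink_ge l t : 0 < l -> l <= 1 -> 0 <= t -> l ^+ q * Phi t <= Phi (l * t).
Proof.
move=> l0 l1; rewrite le_eqVlt => /orP[/eqP <-|t0].
  by rewrite mulr0 (growth_at0 hP) mulr0.
have lt0 : 0 < l * t by rewrite mulr_gt0.
have h : l * t <= t by rewrite ler_piMl // ltW.
have := growth_dec hP lt0 h; rewrite exprMn mulrA ler_pM2r ?exprn_gt0 //.
by rewrite mulrC.
Qed.

End Growth.

(** * Chaining *)

(** V y c stands for the modulus at y of the function with coefficients c. *)
Record modulus {R : realType} {T : Type} (n : nat)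
    (V : T -> 'rV[R]_n -> R) : Prop := {
  modulus_ge0 : forall y c, 0 <= V y c ;
  modulus0 : forall y, V y 0 = 0 ;
  modulus_tri : forall y c c', `|V y c - V y c'| <= V y (c - c') }.

Section Chaining.
Context {R : realType} {T : Type} (D : set T) (cls : set (T -> R))
  (E : (T -> R) -> R) (hE : expectation D cls E).
Context (n : nat) (V : T -> 'rV[R]_n -> R) (hV : modulus V)
  (Phi : R -> R) (q : nat) (a : R) (hP : regular_growth Phi q a).
Context (F : set 'rV[R]_n) (B : R) (B0 : 0 < B).
Hypothesis clsPhi : forall c, cls (fun y => Phi (V y c)).
Hypothesis FB : forall c, F c -> forall y, D y -> V y c <= B.
Hypothesis FE : forall c, F c -> E (fun y => Phi (V y c)) <= 2.

Let Lam := @growth_lip R Phi q a B.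

Lemma modulus_growth_lip c c' d y : F c -> F c' -> D y -> V y (c - c') <= d ->
  `|Phi (V y c) - Phi (V y c')| <= Lam * d.
Proof.
move=> Fc Fc' Dy hd; apply: le_trans (growth_lip_abs hP _ _ _ _ B0) _;
  rewrite ?(modulus_ge0 hV) ?FB //.
rewrite ler_wpM2l ?(ltW (growth_lip_gt0 hP B0)) //.
exact: le_trans (modulus_tri hV y c c') hd.
Qed.

Lemma expect_abs_le f b : cls f -> (forall y, D y -> `|f y| <= b) -> `|E f| <= b.
Proof.
move=> cf hb; rewrite ler_norml; apply/andP; split.
  rewrite -(expect_cst hE (- b)); apply: (expect_le hE) => //; first exact: cls_cst hE _.
  by move=> y /hb; rewrite ler_norml => /andP[].
rewrite -[leRHS](expect_cst hE); apply: (expect_le hE) => //; first exact: cls_cst hE _.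
by move=> y /hb; rewrite ler_norml => /andP[].
Qed.

Lemma expect_var_le f : cls f ->
  E (fun x => (f x - E f) ^+ 2) <= E (fun x => f x ^+ 2).
Proof.
move=> cf.
have csq : cls (fun x => f x ^+ 2).
  by under eq_fun do rewrite expr2; apply: (clsM hE).
have -> : (fun x => (f x - E f) ^+ 2) =
    fun x => f x ^+ 2 + ((- 2 * E f) * f x + E f ^+ 2).
  by apply/funext => x; ring.
have c1 : cls (fun x => (- 2 * E f) * f x) by exact: (clsZ hE).
have c2 : cls (fun=> E f ^+ 2) by exact: cls_cst hE _.
rewrite (expectD hE) //; last exact: (clsD hE).
rewrite (expectD hE) // (expectZ hE) // (expect_cst hE) gerDl.
have -> : -2 * E f * E f + E f ^+ 2 = - E f ^+ 2 by ring.
by rewrite oppr_le0 sqr_ge0.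
Qed.

(** The difference is bounded by Lam * d and also by the sum of its two terms,
    whose mean is at most 4. *)
Lemma link_variance c c' d : F c -> F c' -> 0 <= d ->
  (forall y, D y -> V y (c - c') <= d) ->
  E (fun y => (Phi (V y c) - Phi (V y c')) ^+ 2) <= 4 * (Lam * d).
Proof.
move=> Fc Fc' d0 hd.
have cl : cls (fun y => Phi (V y c) - Phi (V y c')) by exact: (clsB hE).
have csq : cls (fun y => (Phi (V y c) - Phi (V y c')) ^+ 2).
  by under eq_fun do rewrite expr2; apply: (clsM hE).
have cs : cls (fun y => Phi (V y c) + Phi (V y c')) by exact: (clsD hE).
have L0 : 0 <= Lam * d by rewrite mulr_ge0 // ltW // (growth_lip_gt0 hP).
apply: (@le_trans _ _ (E (fun y => (Lam * d) * (Phi (V y c) + Phi (V y c'))))).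
  apply: (expect_le hE) => //; first exact: (clsZ hE).
  move=> y Dy; have h := modulus_growth_lip Fc Fc' Dy (hd y Dy).
  have p1 : 0 <= Phi (V y c) by rewrite (growth_ge0 hP) // (modulus_ge0 hV).
  have p2 : 0 <= Phi (V y c') by rewrite (growth_ge0 hP) // (modulus_ge0 hV).
  rewrite -(real_normK (num_real _)) expr2; apply: ler_pM => //.
  by apply: le_trans (ler_normB _ _) _; rewrite !ger0_norm.
rewrite (expectZ hE) // (expectD hE) // mulrC ler_wpM2r //.
have := FE Fc; have := FE Fc'; lra.
Qed.

(** Every member of the last net is joined to 0 by J links, one for each net, and
    the hypotheses make the sum over all links of the Bernstein bounds at most
    J * 2 exp (- 2 J) <= 1/2. The remaining 1/2 is left for a finite family psi
    to be averaged well by the same points. *)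
Lemma chaining (A : nat -> seq 'rV[R]_n) (dl X : nat -> R) (J : nat) (eta : R)
    (m : nat) (I : finType) (psi : I -> T -> R) (b v eta' : R) :
  (0 < J)%N -> (0 < m)%N -> 0 < eta -> eta <= 4 ->
  A 0%N = [:: 0] ->
  (forall j, (j <= J)%N -> {in A j, forall g, F g}) ->
  (forall j, 0 < dl j) ->
  (forall j, (j < J)%N -> {in A j.+1, forall g, exists2 g', g' \in A j &
      forall y, D y -> V y (g - g') <= dl j}) ->
  (forall j, (j < J)%N -> (size (A j.+1))%:R <= expR (X j)) ->
  (forall j, (j < J)%N ->
     32 * Lam * dl j * (X j + 2 * J%:R) <= m%:R * eta ^+ 2) ->
  0 < v -> 0 < eta' ->
  (forall i, cls (psi i)) ->
  (forall i y, D y -> `|psi i y - E (psi i)| <= b) ->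
  (forall i, E (fun y => (psi i y - E (psi i)) ^+ 2) <= v) ->
  eta' * b <= 2 * v ->
  #|I|%:R * (2 * expR (- (m%:R * eta' ^+ 2 / (8 * v)))) < 1 / 2 ->
  exists x : nat -> T, [/\ forall j, (j < m)%N -> D (x j),
     forall i, `|avg m x (psi i) - E (psi i)| <= eta' &
     forall c g d, F c -> g \in A J -> (forall y, D y -> V y (c - g) <= d) ->
       `|avg m x (fun y => Phi (V y c)) - E (fun y => Phi (V y c))|
          <= J%:R * eta + 2 * Lam * d].
Proof.
move=> J0 m0 eta0 eta4 A0 AF dl0 Apred Asz hm v0 eta'0 cpsi hb hv heb hI.
have mR : 0 < m%:R :> R by rewrite ltr0n.
have L0 : 0 < Lam by exact: (growth_lip_gt0 hP).
have [par hpred] : exists par : nat * 'rV[R]_n -> 'rV[R]_n, forall p,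
    (p.1 < J)%N -> p.2 \in A p.1.+1 -> par p \in A p.1 /\
    forall y, D y -> V y (p.2 - par p) <= dl p.1.
  suff H : forall p : nat * 'rV[R]_n, exists g', (p.1 < J)%N -> p.2 \in A p.1.+1 ->
      g' \in A p.1 /\ forall y, D y -> V y (p.2 - g') <= dl p.1.
    exists (fun p => projT1 (cid (H p))) => p; exact: projT2 (cid (H p)).
  move=> [j g] /=.
  have [jJ|jJ] := boolP (j < J)%N; last by exists 0.
  have [gA|gA] := boolP (g \in A j.+1); last by exists 0.
  by have [g' h1 h2] := Apred j jJ g gA; exists g'.
pose phi c y := Phi (V y c).
pose link (p : nat * 'rV[R]_n) y := phi p.2 y - phi (par p) y.
pose S : seq ((nat * 'rV[R]_n) + I) :=
  [seq inl p | p <- [seq (j, g) | j <- iota 0 J, g <- A j.+1]] ++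
  [seq inr i | i <- enum I].
pose Psi (k : (nat * 'rV[R]_n) + I) := match k with inl p => link p | inr i => psi i end.
pose bb (k : (nat * 'rV[R]_n) + I) : R := match k with inl p => 2 * (Lam * dl p.1) | inr i => b end.
pose vv (k : (nat * 'rV[R]_n) + I) : R := match k with inl p => 4 * (Lam * dl p.1) | inr i => v end.
pose ee (k : (nat * 'rV[R]_n) + I) : R := match k with inl p => eta | inr i => eta' end.
have Sinl p : inl p \in S -> (p.1 < J)%N /\ p.2 \in A p.1.+1.
  rewrite mem_cat => /orP[/mapP[p' + [->]]|/mapP[i _ //]].
  by case/allpairsPdep => j [g [jJ gA ->]] /=; move: jJ; rewrite mem_iota.
have clsphi c : cls (phi c) by exact: clsPhi.
have clink p : cls (link p) by apply: (clsB hE).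
have linkF p : (p.1 < J)%N -> p.2 \in A p.1.+1 -> [/\ F p.2, F (par p) &
    forall y, D y -> V y (p.2 - par p) <= dl p.1].
  move=> pJ pA; have [h1 h2] := hpred p pJ pA.
  by split => //; [exact: AF pA | apply: AF h1; exact: ltnW].
have [||||||| x [Dx hx]] := @select_points R T D cls E hE _ S Psi bb vv ee m m0.
- by case.
- by case=> [p|i] //=; rewrite mulr_gt0 // mulr_gt0.
- by case.
- case=> [p /Sinl[pJ pA]|i _] y Dy /=; last exact: hb.
  have [F1 F2 hd] := linkF p pJ pA.
  have l1 z : D z -> `|link p z| <= Lam * dl p.1.
    by move=> Dz; apply: modulus_growth_lip => //; exact: hd.
  have := expect_abs_le (clink p) l1; have := l1 y Dy => h1 h2.
  by apply: le_trans (ler_normB _ _) _; lra.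
- case=> [p /Sinl[pJ pA]|i _] /=; last exact: hv.
  have [F1 F2 hd] := linkF p pJ pA.
  apply: le_trans (expect_var_le (clink p)) _.
  by apply: link_variance => //; exact: ltW.
- case=> [p _|i _] //=.
  have : 0 < Lam * dl p.1 by rewrite mulr_gt0.
  by move: eta4 eta0; nra.
- rewrite /S big_cat /= !big_map /= [X in _ + X]big_const_seq count_predT.
  rewrite iter_addr_0 -enumT -cardT -[X in _ + X]mulr_natl.
  rewrite big_allpairs_dep /=.
  have t1 : \sum_(j <- iota 0 J) \sum_(g <- A j.+1)
      2 * expR (- (m%:R * eta ^+ 2 / (8 * (4 * (Lam * dl j))))) <= 1 / 2.
    apply: (@le_trans _ _ (\sum_(j <- iota 0 J) 2 * expR (- (2 * J%:R)))).
      rewrite big_seq [leRHS]big_seq; apply: ler_sum => j.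
      rewrite mem_iota add0n => /= jJ.
      rewrite big_const_seq count_predT iter_addr_0 -[leLHS]mulr_natl.
      rewrite mulrCA ler_pM2l //.
      apply: (@le_trans _ _ (expR (X j) * expR (- (m%:R * eta ^+ 2 / (8 * (4 * (Lam * dl j))))))).
        by rewrite ler_wpM2r ?expR_ge0 ?Asz.
      rewrite -expRD ler_expR.
      have Ld : 0 < Lam * dl j by rewrite mulr_gt0.
      have : X j + 2 * J%:R <= m%:R * eta ^+ 2 / (8 * (4 * (Lam * dl j))).
        rewrite ler_pdivlMr; last by do 2?apply: mulr_gt0.
        apply: le_trans (hm j jJ).
        by rewrite le_eqVlt; apply/orP; left; apply/eqP; ring.
      lra.
    rewrite big_const_seq count_predT iter_addr_0 -[leLHS]mulr_natl size_iota.
    have JR : 0 < J%:R :> R by rewrite ltr0n.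
    have e1 : 1 + J%:R <= expR J%:R :> R by exact: expR_ge1Dx.
    have e2 : 4 * J%:R <= expR (2 * J%:R) :> R.
      have -> : 2 * J%:R = J%:R + J%:R :> R by ring.
      rewrite expRD -expr2.
      have : (1 + J%:R) ^+ 2 <= expR J%:R ^+ 2 :> R.
        by rewrite lerXn2r ?nnegrE ?expR_ge0 //; lra.
      have := sqr_ge0 (1 - J%:R : R); nra.
    rewrite expRN mulrA ler_pdivrMr ?expR_gt0 //; lra.
  apply: le_lt_trans (lerD t1 (lexx _)) _; lra.
exists x; split => //.
  move=> i; have := hx (inr i); apply.
  by rewrite mem_cat (map_f inr) ?orbT // mem_enum.
have avgB f g : avg m x (fun y => f y - g y) = avg m x f - avg m x g.
  by rewrite /avg sumrB mulrBr.
have net j : (j <= J)%N -> {in A j, forall g,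
    `|avg m x (phi g) - E (phi g)| <= j%:R * eta}.
  elim: j => [_|j ih jJ] g.
    rewrite A0 inE => /eqP ->.
    have -> : phi 0 = fun=> 0.
      by apply/funext => y; rewrite /phi (modulus0 hV) (growth_at0 hP).
    by rewrite (expect_cst hE) /avg big1 // mulr0 subrr normr0 mul0r.
  move=> gA; have [pA _] := hpred (j, g) jJ gA.
  have := ih (ltnW jJ) _ pA => /= h1.
  have : `|avg m x (link (j, g)) - E (link (j, g))| <= eta.
    apply: (hx (inl (j, g))); rewrite mem_cat; apply/orP; left.
    apply: map_f; apply/allpairsPdep; exists j, g; split => //.
    by rewrite mem_iota.
  rewrite /link /= avgB (expectB hE) // => h2.
  have -> : avg m x (phi g) - E (phi g) =
     (avg m x (phi g) - avg m x (phi (par (j, g))) - (E (phi g) - E (phi (par (j, g)))))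
     + (avg m x (phi (par (j, g))) - E (phi (par (j, g)))) by ring.
  apply: le_trans (ler_normD _ _) _; rewrite -natr1 mulrDl mul1r; lra.
move=> c g d Fc gA hd; have Fg := AF J (leqnn J) g gA.
have l1 z : D z -> `|phi c z - phi g z| <= Lam * d.
  by move=> Dz; apply: modulus_growth_lip => //; exact: hd.
have e1 : `|E (phi c) - E (phi g)| <= Lam * d.
  by rewrite -(expectB hE) //; apply: expect_abs_le => //; exact: (clsB hE).
have e2 : `|avg m x (phi c) - avg m x (phi g)| <= Lam * d.
  rewrite -avgB /avg normrM ger0_norm ?invr_ge0 // ler_pdivrMl //.
  apply: le_trans (ler_norm_sum _ _ _) _.
  rewrite mulr_natl -[X in _ *+ X]card_ord -sumr_const.
  by apply: ler_sum => j _; apply: l1; exact: Dx.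
have e3 := net J (leqnn J) g gA.
have -> : avg m x (phi c) - E (phi c) =
    (avg m x (phi c) - avg m x (phi g)) + (avg m x (phi g) - E (phi g))
    - (E (phi c) - E (phi g)) by ring.
apply: le_trans (ler_normB _ _) _.
have := ler_normD (avg m x (phi c) - avg m x (phi g)) (avg m x (phi g) - E (phi g)).
lra.
Qed.

End Chaining.

(** * Entropy on a finite sample *)

Section Hypot.
Context {R : realType}.
Implicit Types a b c d : R.

Definition hypot a b : R := Num.sqrt (a ^+ 2 + b ^+ 2).

Lemma hypot_ge0 a b : 0 <= hypot a b. Proof. exact: sqrtr_ge0. Qed.

Lemma hypot_sqr a b : hypot a b ^+ 2 = a ^+ 2 + b ^+ 2.
Proof. by rewrite sqr_sqrtr // addr_ge0 ?sqr_ge0. Qed.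

Lemma hypot_le a b t : 0 <= t -> (hypot a b <= t) = (a ^+ 2 + b ^+ 2 <= t ^+ 2).
Proof. by move=> t0; rewrite -hypot_sqr ler_sqr // nnegrE hypot_ge0. Qed.

Lemma hypot0 a : hypot a 0 = `|a|.
Proof. by rewrite /hypot expr0n addr0 sqrtr_sqr. Qed.

Lemma hypotN a b : hypot (- a) (- b) = hypot a b.
Proof. by rewrite /hypot !sqrrN. Qed.

Lemma hypotD a b c d : hypot (a + c) (b + d) <= hypot a b + hypot c d.
Proof.
have n1 := hypot_ge0 a b; have n2 := hypot_ge0 c d.
rewrite hypot_le ?addr_ge0 // (sqrrD (hypot a b)) !hypot_sqr.
suff : a * c + b * d <= hypot a b * hypot c d by nra.
apply: le_trans (ler_norm _) _; rewrite -ler_sqr ?nnegrE ?mulr_ge0 //.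
rewrite real_normK ?num_real // exprMn !hypot_sqr -subr_ge0.
have -> : (a ^+ 2 + b ^+ 2) * (c ^+ 2 + d ^+ 2) - (a * c + b * d) ^+ 2 =
  (a * d - b * c) ^+ 2 by ring.
exact: sqr_ge0.
Qed.

Lemma hypot_le_sum a b : hypot a b <= `|a| + `|b|.
Proof.
rewrite hypot_le ?addr_ge0 // (sqrrD `|a|) !real_normK ?num_real //.
by have : 0 <= `|a| * `|b|; [rewrite mulr_ge0|lra].
Qed.

End Hypot.

Section PlaneModulus.
Context {R : realType} {T : Type} {n : nat} (p r : 'I_n -> T -> R).
Implicit Types (c : 'rV[R]_n).

Definition lincomb (u : 'I_n -> T -> R) (y : T) c := \sum_i c 0 i * u i y.

Lemma lincombB u y c c' : lincomb u y (c - c') = lincomb u y c - lincomb u y c'.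
Proof. by rewrite /lincomb -sumrB; apply: eq_bigr => i _; rewrite !mxE mulrBl. Qed.

(** The modulus of a function whose real and imaginary parts have coefficients c
    in the families p and r. *)
Definition modV (y : T) c := hypot (lincomb p y c) (lincomb r y c).

Lemma modVB y c c' : modV y (c - c') <= modV y c + modV y c'.
Proof.
rewrite /modV !lincombB -(hypotN (lincomb p y c')); exact: hypotD.
Qed.

Lemma modV_modulus : modulus modV.
Proof.
split => [y c|y|y c c'].
- exact: hypot_ge0.
- rewrite /modV /lincomb !big1 => [||i _]; try by move=> i _; rewrite mxE mul0r.
    by rewrite /hypot expr0n addr0 sqrtr0.
  by rewrite mxE mul0r.
- have h1 : modV y c <= modV y (c - c') + modV y c'.
    rewrite /modV !lincombB -[X in hypot X _ <= _](subrK (lincomb p y c')).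
    rewrite -[X in hypot _ X <= _](subrK (lincomb r y c')); exact: hypotD.
  have h2 : modV y c' <= modV y (c - c') + modV y c.
    rewrite /modV !lincombB -[X in _ <= X + _]hypotN !opprB.
    rewrite -[X in hypot X _ <= _](subrK (lincomb p y c)).
    rewrite -[X in hypot _ X <= _](subrK (lincomb r y c)); exact: hypotD.
  by rewrite ler_norml; apply/andP; split; lra.
Qed.

Lemma lincomb_coord_le (u : 'I_n -> T -> R) y c (h g : R) : 0 <= h ->
  \sum_i u i y ^+ 2 <= h ^+ 2 -> (forall i, `|c 0 i| <= g) ->
  `|lincomb u y c| <= n%:R * (g * h).
Proof.
move=> h0 hu hc; apply: le_trans (ler_norm_sum _ _ _) _.
rewrite -[n in n%:R]card_ord mulr_natl -sumr_const; apply: ler_sum => i _.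
rewrite normrM; apply: ler_pM => //.
have := @sumsq_coord_le R n (\row_j u j y) h i h0.
by rewrite mxE; apply; under eq_bigr do rewrite mxE.
Qed.

(** This count is logarithmic in 1 / d, and is the better one at radii d below
    about h^2 / n. *)
Lemma fine_packing (D : set T) (F : set 'rV[R]_n) (h K d : R) :
  (0 < n)%N -> 0 < h -> 0 <= K -> 0 < d ->
  (forall y, D y -> \sum_i p i y ^+ 2 <= h ^+ 2) ->
  (forall y, D y -> \sum_i r i y ^+ 2 <= h ^+ 2) ->
  (forall c, F c -> \sum_i c 0 i ^+ 2 <= (h * K) ^+ 2) ->
  packing_le modV D F d ((4 * h ^+ 2 * K * n%:R / d + 1) ^+ n).
Proof.
move=> n0 h0 K0 d0 hp hr hF.
have nR : 0 < n%:R :> R by rewrite ltr0n.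
have g0 : 0 < d / (2 * h * n%:R) by rewrite divr_gt0 // !mulr_gt0.
have -> : 4 * h ^+ 2 * K * n%:R / d = 2 * (h * K) / (d / (2 * h * n%:R)).
  by field; lra.
have hK0 : 0 <= h * K by rewrite mulr_ge0 // ltW.
apply: packing_grid => //.
  by move=> c Fc i; apply: sumsq_coord_le => //; exact: hF.
move=> c c' /asboolP[y Dy hd]; apply: contrapT => hn.
have hg i : `|(c - c') 0 i| <= d / (2 * h * n%:R).
  by rewrite leNgt; apply/negP => hi; apply: hn; exists i.
have := hypot_le_sum (lincomb p y (c - c')) (lincomb r y (c - c')).
have := lincomb_coord_le (ltW h0) (hp y Dy) hg.
have := lincomb_coord_le (ltW h0) (hr y Dy) hg.
have -> : n%:R * (d / (2 * h * n%:R) * h) = d / 2 by field; lra.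
by move: hd; rewrite /modV; lra.
Qed.

End PlaneModulus.

Lemma expR1_le4 {R : realType} : expR 1 <= 4 :> R.
Proof.
have h : expR (1 / 2) <= 2 :> R.
  by have := @expR_le_quadratic R (1 / 2) (lexx _); lra.
have -> : expR 1 = expR (1 / 2) ^+ 2 :> R by rewrite expr2 -expRD; congr expR; lra.
have := expR_ge0 (1 / 2 : R); nra.
Qed.

Section SampleEntropy.
Context {R : realType} {T : Type} {n : nat} (p r : 'I_n -> T -> R).
Context (M : nat) (y : nat -> T) (F : set 'rV[R]_n) (h K : R).
Let V := modV p r.
Let D := [set z | exists2 k, (k < M)%N & z = y k].
Hypothesis M0 : (0 < M)%N.
Hypothesis h0 : 0 < h.
Hypothesis K0 : 0 < K.
Hypothesis hp : forall z, D z -> \sum_i p i z ^+ 2 <= h ^+ 2.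
Hypothesis hr : forall z, D z -> \sum_i r i z ^+ 2 <= h ^+ 2.
Hypothesis FK : forall c, F c -> avg M y (fun z => V z c) <= K.
Hypothesis FB : forall c, F c -> forall z, D z -> V z c <= h ^+ 2 * K.
Hypothesis gram : forall c : 'rV[R]_n,
  \sum_i c 0 i ^+ 2 <= 2 * avg M y (fun z => V z c ^+ 2).

Let L := ln (8 * M%:R) : R.

(** Pointwise |f - g|^2 <= d (|f| + |g|), and the means of |f| and |g| are at most
    K. *)
Lemma sample_ball_l2 (d : R) c g : F c -> F g -> 0 <= d -> 
  (forall z, D z -> V z (c - g) <= d) -> \sum_i (c - g) 0 i ^+ 2 <= 4 * K * d.
Proof.
move=> Fc Fg d0 hd; apply: le_trans (gram _) _.
have : avg M y (fun z => V z (c - g) ^+ 2) <= d * (2 * K); last by lra.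
apply: (@le_trans _ _ (d * (avg M y (fun z => V z c) + avg M y (fun z => V z g)))).
  rewrite /avg -mulrDr mulrCA ler_wpM2l ?invr_ge0 // -big_split /= mulr_sumr.
  apply: ler_sum => j _; rewrite expr2; apply: ler_pM => //.
  - exact: hypot_ge0.
  - exact: hypot_ge0.
  - by apply: hd; exists (val j) => //; exact: ltn_ord.
  - exact: modVB.
by rewrite ler_wpM2l //; have := FK Fc; have := FK Fg; lra.
Qed.

Lemma ln8M_ge1 : 1 <= L.
Proof.
rewrite -[leLHS](expRK (1 : R)) /L ler_ln ?posrE ?expR_gt0 ?mulr_gt0 ?ltr0n //.
apply: le_trans expR1_le4 _; have : 1 <= M%:R :> R by rewrite ler1n.
lra.
Qed.

(** Within F, the ball of radius 2 d around g lies in a Euclidean ball of radius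
    sqrt (8 K d), and a modulus above d at a sample point forces the real or the
    imaginary part above d / 2. The dual Sudakov inequality gives an exponent of
    order h^2 (8 K d) ln (8 M) / d^2. *)
Lemma sample_local_packing (d : R) g : F g -> 0 < d -> d <= h ^+ 2 * K ->
  packing_le V D [set c | F c /\ ~~ far V D (2 * d) c g] d
    (expR (1027 * (h ^+ 2 * K * L) / d)).
Proof.
move=> Fg d0 dB s hs ps.
have h20 : 0 < h ^+ 2 by rewrite exprn_gt0.
have L1 := ln8M_ge1.
pose nu := (Num.truncn (1024 * (h ^+ 2 * K * L) / d)).+1.
have x0 : 0 <= 1024 * (h ^+ 2 * K * L) / d.
  have L0 : 0 <= L by apply: le_trans L1.
  exact: divr_ge0 (mulr_ge0 (ler0n _ _) (mulr_ge0 (mulr_ge0 (ltW h20) (ltW K0)) L0)) (ltW d0).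
have nu1 : 1024 * (h ^+ 2 * K * L) / d <= nu%:R by rewrite ltW // truncnS_gt.
have nu2 : nu%:R <= 1024 * (h ^+ 2 * K * L) / d + 1.
  by rewrite /nu -natr1 lerD2r truncn_le.
have rho0 : 0 < Num.sqrt (8 * K * d) by rewrite sqrtr_gt0 !mulr_gt0.
have rho2 : Num.sqrt (8 * K * d) ^+ 2 = 8 * K * d.
  by rewrite sqr_sqrtr // !mulr_ge0 // ltW.
pose kk (i : 'I_M * bool) : 'rV[R]_n :=
  \row_j (if i.2 then p j (y i.1) else r j (y i.1)).
have Dy (i : 'I_M) : D (y i) by exists (val i) => //; exact: ltn_ord.
have main : (size s)%:R <= 4 * expR nu%:R :> R.
  apply: (@dual_sudakov _ _ nu ('I_M * bool)%type kk h (d / 2) (Num.sqrt (8 * K * d)) g) => //.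
  - by rewrite divr_gt0.
  - rewrite -ler_sqr ?nnegrE ?divr_ge0 ?mulr_ge0 ?(ltW d0) ?(ltW h0) ?(ltW rho0) //.
    rewrite [leRHS]exprMn rho2.
    have -> : (d / 2) ^+ 2 = d * (d / 4) by field.
    have -> : (2 * h) ^+ 2 * (8 * K * d) = d * (32 * (h ^+ 2 * K)) by ring.
    by rewrite ler_pM2l //; lra.
  - case=> i [] /=; under eq_bigr do rewrite mxE /=; [exact: hp|exact: hr].
  - move=> c /hs[Fc nf]; rewrite rho2.
    have -> : 8 * K * d = 4 * K * (2 * d) by ring.
    apply: sample_ball_l2 => //; first by rewrite mulr_ge0 // ltW.
    exact: nfarP nf.
  - apply: sub_pairwise ps => c c' /asboolP[_ [j jM ->] hd].
    have lc b : \sum_j0 (c - c') 0 j0 * kk (Ordinal jM, b) 0 j0 =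
        lincomb (if b then p else r) (y j) (c - c').
      by apply: eq_bigr => i _; congr (_ * _); rewrite mxE; case: b.
    case: (ltP (d / 2) `|lincomb p (y j) (c - c')|) => h1.
      by apply/existsP; exists (Ordinal jM, true); rewrite lc.
    apply/existsP; exists (Ordinal jM, false); rewrite lc /=.
    have := hypot_le_sum (lincomb p (y j) (c - c')) (lincomb r (y j) (c - c')).
    by move: hd; rewrite /V /modV; lra.
  - rewrite rho2 card_prod card_ord card_bool natrM.
    have -> : 4 * (M%:R * 2%:R) = 8 * M%:R :> R by ring.
    rewrite -/L.
    move: nu1; rewrite ler_pdivrMr // => nu1.
    have -> : 32 * h ^+ 2 * (8 * K * d) * L = d / 4 * (1024 * (h ^+ 2 * K * L)) by field.
    have -> : nu%:R * (d / 2) ^+ 2 = d / 4 * (nu%:R * d) by field.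
    by rewrite ler_pM2l ?divr_gt0.
apply: le_trans main _.
have e4 : 4 <= expR 2 :> R.
  have -> : 2 = 1 + 1 :> R by ring.
  rewrite expRD; have := expR_ge1Dx (1 : R); nra.
apply: (@le_trans _ _ (expR 2 * expR nu%:R)); first by rewrite ler_wpM2r ?expR_ge0.
rewrite -expRD ler_expR.
have : 1 <= h ^+ 2 * K * L / d.
  rewrite ler_pdivlMr // mul1r; apply: le_trans dB _.
  by rewrite ler_peMr // mulr_ge0 ?(ltW h20) ?(ltW K0).
have -> : 1027 * (h ^+ 2 * K * L) / d = 1024 * (h ^+ 2 * K * L) / d + 3 * (h ^+ 2 * K * L / d).
  by field; lra.
lra.
Qed.

(** The exponents added by successive halvings of the radius form a geometric
    series, dominated by its last term. *)
Lemma sample_entropy j :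
  packing_le V D F (h ^+ 2 * K / 2 ^+ j) (expR (2054 * L * 2 ^+ j)).
Proof.
have h20 : 0 < h ^+ 2 by rewrite exprn_gt0.
have B0 : 0 < h ^+ 2 * K by rewrite mulr_gt0.
have L1 := ln8M_ge1.
have step j' X : packing_le V D F (2 * (h ^+ 2 * K / 2 ^+ j')) (expR X) ->
    packing_le V D F (h ^+ 2 * K / 2 ^+ j') (expR (X + 1027 * L * 2 ^+ j')).
  move=> hX; have tj : 0 < 2 ^+ j' :> R by rewrite exprn_gt0.
  have t1 : 1 <= 2 ^+ j' :> R by rewrite exprn_ege1 //; lra.
  rewrite expRD; apply: packing_refine hX _; first exact: expR_ge0.
  move=> g Fg.
  have -> : 1027 * L * 2 ^+ j' = 1027 * (h ^+ 2 * K * L) / (h ^+ 2 * K / 2 ^+ j').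
    by field; rewrite ?(gt_eqF h0) ?(gt_eqF K0) ?(gt_eqF tj).
  apply: sample_local_packing => //; first by rewrite divr_gt0.
  by rewrite ler_pdivrMr // ler_peMr // ltW.
elim: j => [|j ih].
  have : packing_le V D F (2 * (h ^+ 2 * K / 2 ^+ 0)) (expR 0).
    move=> s Fs; rewrite expR0 expr0 divr1; case: s Fs => [|c [|c' s]] Fs //=.
    case/andP => /andP[/asboolP[z Dz hz] _] _.
    have Fc : F c by apply: Fs; rewrite inE eqxx.
    have Fc' : F c' by apply: Fs; rewrite !inE eqxx orbT.
    have := modVB p r z c c'; have := FB Fc Dz; have := FB Fc' Dz.
    by move: hz; rewrite /V; lra.
  move=> /step; apply: (fun h1 h2 => _).
  move=> h1 s Fs ps; apply: le_trans (h1 s Fs ps) _; rewrite ler_expR expr0; lra.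
have tj : 0 < 2 ^+ j :> R by rewrite exprn_gt0.
have e : 2 * (h ^+ 2 * K / 2 ^+ j.+1) = h ^+ 2 * K / 2 ^+ j.
  by rewrite [2 ^+ j.+1]exprS; move: (2 ^+ j) tj => t t0; field; rewrite gt_eqF.
have := ih; rewrite -e => /step.
have -> : 2054 * L * 2 ^+ j + 1027 * L * 2 ^+ j.+1 = 2054 * L * 2 ^+ j.+1.
  by rewrite [2 ^+ j.+1]exprS; move: (2 ^+ j) => t; ring.
by [].
Qed.

End SampleEntropy.

(** * Sampling for an orthonormal family *)

Lemma avg_expectation {R : realType} {T : Type} (M : nat) (y : nat -> T) :
  (0 < M)%N ->
  expectation [set z | exists2 k, (k < M)%N & z = y k] setT (@avg R T M y).
Proof.
move=> M0; have MR : M%:R != 0 :> R by rewrite pnatr_eq0 -lt0n.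
split=> //.
- by move=> b; rewrite /avg sumr_const card_ord -[X in _ * X]mulr_natl mulKf.
- by move=> f g _ _; rewrite /avg big_split mulrDr.
- by move=> b f _; rewrite /avg -mulr_sumr mulrCA.
- move=> f g _ _ h; rewrite /avg ler_wpM2l ?invr_ge0 //; apply: ler_sum => j _.
  by apply: h; exists (val j) => //; exact: ltn_ord.
Qed.

Ltac nz := by rewrite !gt_eqF.

Section Discretization.
Context {R : realType} {T : Type} (D : set T) (cls : set (T -> R))
  (E : (T -> R) -> R) (hE : expectation D cls E).
Context {n : nat} (p r : 'I_n -> T -> R).
Context (Phi : R -> R) (q : nat) (a : R) (hP : regular_growth Phi q a).
Context (F : set 'rV[R]_n) (h eps : R).
Let V := modV p r.
Let K := 1 + 2 * (a / Phi 1).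
Let B := h ^+ 2 * K.
Let Lam := @growth_lip R Phi q a B.
Let Lf := ln (32 * (Lam * B) * n%:R / eps + 1).
Let psi (ij : 'I_n * 'I_n) y := p ij.1 y * p ij.2 y + r ij.1 y * r ij.2 y.
Hypothesis n0 : (0 < n)%N.
Hypothesis h1 : 1 <= h.
Hypothesis eps0 : 0 < eps.
Hypothesis eps1 : eps <= 1 / 2.
Hypothesis clsPhi : forall c, cls (fun y => Phi (V y c)).
Hypothesis clspsi : forall ij, cls (psi ij).
Hypothesis Epsi : forall i j, E (psi (i, j)) = (i == j)%:R.
Hypothesis hp : forall y, D y -> \sum_i p i y ^+ 2 <= h ^+ 2.
Hypothesis hr : forall y, D y -> \sum_i r i y ^+ 2 <= h ^+ 2.
Hypothesis F0 : F 0.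
Hypothesis FE : forall c, F c -> E (fun y => Phi (V y c)) <= 1.
Hypothesis F2 : forall c, F c -> \sum_i c 0 i ^+ 2 <= (h * K) ^+ 2.
Hypothesis FB : forall c, F c -> forall y, D y -> V y c <= B.

Let M_bound := 512 * (Lam * B) * (n%:R * Lf + 2) / eps ^+ 2
  + 2048 * (n%:R ^+ 4 * h ^+ 4) + 1.

Let K1 : 1 <= K.
Proof.
have p1 := growth_gt0 hP ltr01; have a1 := growth_a1 hP.
have : 0 <= a / Phi 1 by rewrite divr_ge0 ?ltW //; lra.
by rewrite /K; lra.
Qed.

Let h0 : 0 < h. Proof. exact: lt_le_trans h1. Qed.
Let K0 : 0 < K. Proof. exact: lt_le_trans K1. Qed.
Let B0 : 0 < B. Proof. by rewrite mulr_gt0 ?exprn_gt0. Qed.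
Let Lam0 : 0 < Lam. Proof. exact: growth_lip_gt0. Qed.
Let nR : 0 < n%:R :> R. Proof. by rewrite ltr0n. Qed.
Let nR1 : 1 <= n%:R :> R. Proof. by rewrite ler1n. Qed.
Let LB0 : 0 < Lam * B. Proof. exact: mulr_gt0. Qed.

Let x0 : 0 < 32 * (Lam * B) * n%:R / eps.
Proof. by apply: divr_gt0 => //; do 2?apply: mulr_gt0. Qed.

Let Lf0 : 0 <= Lf.
Proof. by rewrite /Lf ln_ge0 //; have := x0; lra. Qed.

Lemma fine_net (D' : set T) : (forall y, D' y -> D y) -> exists s : seq 'rV[R]_n,
  [/\ {in s, forall c, F c}, (size s)%:R <= expR (n%:R * Lf) &
   forall c, F c -> exists2 g, g \in s & forall y, D' y ->
      V y (c - g) <= eps / (8 * Lam)].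
Proof.
have l0 := Lam0; have b0 := B0; have hh0 := h0; have nn0 := nR; have nn1 := nR1.
have lb0 := LB0; have kk0 := K0; have ep0 := eps0; have ep1 := eps1; have hh1 := h1.
move=> DD.
have d0 : 0 < eps / (8 * Lam) by rewrite divr_gt0 // mulr_gt0.
have := @fine_packing R T n p r D' F h K _ n0 h0 (ltW K0) d0
  (fun y Dy => hp (DD y Dy)) (fun y Dy => hr (DD y Dy)) F2.
move/net_of_packing => [s [Fs _ ss cov]]; exists s; split => //.
  apply: le_trans ss _; rewrite expRM_natl /Lf lnK.
    have -> : 4 * h ^+ 2 * K * n%:R / (eps / (8 * Lam)) = 32 * (Lam * B) * n%:R / eps.
      by rewrite /B; field; nz.
    by [].
  by rewrite posrE; have := x0; lra.
move=> c Fc; have [g gs ng] := cov c Fc; exists g => //; exact: nfarP ng.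
Qed.

Lemma psi_le ij y : D y -> `|psi ij y| <= 2 * h ^+ 2.
Proof.
have l0 := Lam0; have b0 := B0; have hh0 := h0; have nn0 := nR; have nn1 := nR1.
have lb0 := LB0; have kk0 := K0; have ep0 := eps0; have ep1 := eps1; have hh1 := h1.
case: ij => i j Dy; rewrite /psi /=.
have co (u : 'I_n -> T -> R) k : \sum_i u i y ^+ 2 <= h ^+ 2 -> `|u k y| <= h.
  move=> hu; have := @sumsq_coord_le R n (\row_j u j y) h k (ltW h0).
  by rewrite mxE; apply; under eq_bigr do rewrite mxE.
apply: le_trans (ler_normD _ _) _; rewrite !normrM.
have -> : 2 * h ^+ 2 = h * h + h * h by ring.
by apply: lerD; apply: ler_pM => //; apply: co; [exact: hp|exact: hp|exact: hr|exact: hr].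
Qed.

Lemma modV_sqr y c : V y c ^+ 2 = \sum_i \sum_j c 0 i * c 0 j * psi (i, j) y.
Proof.
rewrite /V /modV hypot_sqr /lincomb !expr2 !mulr_suml -big_split /=.
apply: eq_bigr => i _; rewrite !mulr_sumr -big_split /=.
by apply: eq_bigr => j _; rewrite /psi /=; ring.
Qed.

(** An error 1 / (2 n) in the entries of the Gram matrix changes its quadratic form
    by at most half of the square of the Euclidean norm. *)
Lemma gram_perturbation (M : nat) (y : nat -> T) :
  (forall ij, `|avg M y (psi ij) - E (psi ij)| <= 1 / (2 * n%:R)) ->
  forall c : 'rV[R]_n, \sum_i c 0 i ^+ 2 <= 2 * avg M y (fun z => V z c ^+ 2).
Proof.
have l0 := Lam0; have b0 := B0; have hh0 := h0; have nn0 := nR; have nn1 := nR1.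
have lb0 := LB0; have kk0 := K0; have ep0 := eps0; have ep1 := eps1; have hh1 := h1.
move=> hM c.
have e1 : avg M y (fun z => V z c ^+ 2) =
    \sum_i \sum_j c 0 i * c 0 j * avg M y (psi (i, j)).
  rewrite /avg; under eq_bigr do rewrite modV_sqr.
  rewrite exchange_big mulr_sumr; apply: eq_bigr => i _.
  rewrite exchange_big mulr_sumr; apply: eq_bigr => j _.
  by rewrite -mulr_sumr mulrCA.
have e2 : \sum_i c 0 i ^+ 2 = \sum_i \sum_j c 0 i * c 0 j * (i == j)%:R.
  apply: eq_bigr => i _; rewrite (bigD1 i) //= eqxx mulr1 big1 ?addr0 // => j ji.
  by rewrite eq_sym (negbTE ji) mulr0.
have e3 : \sum_i \sum_j (c 0 i ^+ 2 + c 0 j ^+ 2) / 2 * (1 / (2 * n%:R))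
     = \sum_i c 0 i ^+ 2 / 2.
  under eq_bigr do rewrite -mulr_suml -mulr_suml.
  rewrite -!mulr_suml; under eq_bigr do rewrite big_split /=.
  rewrite big_split /= sumr_const card_ord.
  under [X in X + _]eq_bigr do rewrite sumr_const card_ord -mulr_natl.
  by rewrite -mulr_sumr -[X in _ + X]mulr_natl; field; nz.
have : \sum_i c 0 i ^+ 2 - avg M y (fun z => V z c ^+ 2) <= \sum_i c 0 i ^+ 2 / 2.
  rewrite -e3 e1 {1}e2 -sumrB; apply: ler_sum => i _; rewrite -sumrB.
  apply: ler_sum => j _; rewrite -mulrBr -Epsi.
  apply: le_trans (ler_norm _) _; rewrite normrM distrC.
  apply: ler_pM => //.
  rewrite normrM; have := sqr_ge0 (`|c 0 i| - `|c 0 j|).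
  have := real_normK (num_real (c 0 i)); have := real_normK (num_real (c 0 j)).
  nra.
rewrite -mulr_suml; lra.
Qed.

(** A single link, of radius B, from 0 to a fine grid net. The resulting number of
    points is far too large, but polynomial in n, h, Lam * B and 1 / eps, so that its
    logarithm is admissible in the entropy estimate. Controlling the Gram matrix at
    the same points keeps the L^2 structure on the sample. *)
Lemma crude_sample : exists (M : nat) (y : nat -> T),
  [/\ (0 < M)%N, M%:R <= M_bound, forall k, (k < M)%N -> D (y k),
      forall c : 'rV[R]_n, \sum_i c 0 i ^+ 2 <= 2 * avg M y (fun z => V z c ^+ 2)
    & forall c, F c ->
      `|avg M y (fun z => Phi (V z c)) - E (fun z => Phi (V z c))| <= eps / 2].
Proof.
have l0 := Lam0; have b0 := B0; have hh0 := h0; have nn0 := nR; have nn1 := nR1.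
have lb0 := LB0; have kk0 := K0; have ep0 := eps0; have ep1 := eps1; have hh1 := h1.
pose x := 512 * (Lam * B) * (n%:R * Lf + 2) / eps ^+ 2 + 2048 * (n%:R ^+ 4 * h ^+ 4).
have nL0 : 0 <= n%:R * Lf + 2.
  by apply: addr_ge0 => //; apply: mulr_ge0 => //; exact: ltW.
have y1 : 0 <= 512 * (Lam * B) * (n%:R * Lf + 2) / eps ^+ 2 :=
  divr_ge0 (mulr_ge0 (mulr_ge0 (ler0n _ _) (ltW lb0)) nL0) (sqr_ge0 _).
have y2 : 0 <= n%:R ^+ 4 * h ^+ 4 by apply: mulr_ge0; apply: exprn_ge0; exact: ltW.
have x00 : 0 <= x by rewrite /x; lra.
pose M := (Num.truncn x).+1.
have xM : x < M%:R by exact: truncnS_gt.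
have [s [Fs ss cov]] := fine_net (fun y Dy => Dy).
pose A (j : nat) := if j == 0%N then [:: 0] else s.
have FE2 c : F c -> E (fun y => Phi (V y c)) <= 2 by move=> /FE; lra.
have h2 : 1 <= h ^+ 2 by exact: exprn_ege1.
have e4 : h ^+ 4 = h ^+ 2 * h ^+ 2 by ring.
have hpsi ij y : D y -> `|psi ij y - E (psi ij)| <= 4 * h ^+ 2.
  move=> Dy; apply: le_trans (ler_normB _ _) _.
  have := psi_le ij Dy; have := expect_abs_le hE (clspsi ij) (fun y => @psi_le ij y).
  lra.
have cpsiB ij : cls (fun y => (psi ij y - E (psi ij)) ^+ 2).
  under eq_fun do rewrite expr2.
  have c1 : cls (fun y => psi ij y - E (psi ij)).
    by apply: (clsB hE) => //; exact: cls_cst hE _.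
  exact: (clsM hE).
have := @chaining R T D cls E hE n V (modV_modulus p r) Phi q a hP F B B0 clsPhi FB FE2
  A (fun=> B) (fun=> n%:R * Lf) 1 (eps / 4) M _ psi (4 * h ^+ 2) (16 * h ^+ 4)
  (1 / (2 * n%:R)).
case=> //.
- by rewrite divr_gt0.
- by lra.
- case=> [|j] jJ g /=; first by rewrite /A eqxx inE => /eqP ->.
  exact: Fs.
- case=> [|//] _ g gA; exists 0; first by rewrite inE.
  by move=> y Dy; rewrite subr0; apply: FB => //; exact: Fs.
- case=> [|//] _.
  have -> : 32 * @growth_lip R Phi q a B * B * (n%:R * Lf + 2 * 1) =
    512 * (Lam * B) * (n%:R * Lf + 2) / eps ^+ 2 * (eps / 4) ^+ 2.
    by rewrite -/Lam; field; nz.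
  by rewrite ler_wpM2r ?sqr_ge0 // ltW // (le_lt_trans _ xM) // /x; lra.
- by apply: mulr_gt0 => //; rewrite exprn_gt0.
- by rewrite divr_gt0 // mulr_gt0.
- move=> ij; rewrite -[leRHS](expect_cst hE); apply: (expect_le hE) => //.
    exact: cls_cst hE _.
  move=> y Dy; rewrite -(real_normK (num_real _)).
  have -> : 16 * h ^+ 4 = (4 * h ^+ 2) ^+ 2 by ring.
  by rewrite lerXn2r ?nnegrE ?hpsi //; lra.
- rewrite mulrAC ler_pdivrMr ?mulr_gt0 //.
  apply: (@le_trans _ _ (2 * (16 * h ^+ 4))); first by rewrite e4; nra.
  rewrite ler_peMr //; first by rewrite e4; nra.
  lra.
- rewrite card_prod !card_ord natrM.
  have hx : 4 * (n%:R * n%:R) <= M%:R * (1 / (2 * n%:R)) ^+ 2 / (8 * (16 * h ^+ 4)).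
    rewrite ler_pdivlMr; last by do 2?apply: mulr_gt0 => //; rewrite exprn_gt0.
    have -> : M%:R * (1 / (2 * n%:R)) ^+ 2 = M%:R / (4 * n%:R ^+ 2) :> R by field; nz.
    rewrite ler_pdivlMr; last by rewrite mulr_gt0 // exprn_gt0.
    have -> : 4 * (n%:R * n%:R) * (8 * (16 * h ^+ 4)) * (4 * n%:R ^+ 2) =
       2048 * (n%:R ^+ 4 * h ^+ 4) :> R by ring.
    by apply: ltW; apply: le_lt_trans xM; rewrite /x; lra.
  set z := M%:R * _ / _ in hx *.
  have := expR_ge1Dx z => ez.
  rewrite expRN mulrA ltr_pdivrMr ?expR_gt0 //; lra.
move=> y [Dy hpsi2 hphi].
exists M, y; split => //.
- by rewrite /M_bound -/x /M -natr1 lerD2r truncn_le.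
- exact: gram_perturbation.
- move=> c Fc; have [g gs hg] := cov c Fc.
  have := hphi c g _ Fc gs hg; rewrite -/Lam mul1r.
  have -> : 2 * Lam * (eps / (8 * Lam)) = eps / 4 by field; nz.
  by have -> : eps / 4 + eps / 4 = eps / 2 by field.
Qed.

(** The second sample is taken from the first. At the radii B / 2^j the exponent of
    the entropy estimate grows like 2^j, so that the radius times the exponent is
    the same at every scale. As 2^(J - 1) >= n, the last link, of radius at most
    B / n, can afford the exponent n * Lf of the grid net. *)
Theorem orlicz_sampling (J : nat) : (0 < J)%N -> (n <= 2 ^ J.-1)%N ->
  exists (m : nat) (x : nat -> T),
  [/\ (0 < m)%N,
      m%:R <= 512 * (Lam * B) * J%:R ^+ 2 *
         (4108 * ln (8 * M_bound) + Lf + 2 * J%:R) / eps ^+ 2 + 1,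
      forall k, (k < m)%N -> D (x k)
    & forall c, F c ->
      `|avg m x (fun z => Phi (V z c)) - E (fun z => Phi (V z c))| <= eps].
Proof.
have l0 := Lam0; have b0 := B0; have hh0 := h0; have nn0 := nR; have nn1 := nR1.
have lb0 := LB0; have kk0 := K0; have ep0 := eps0; have ep1 := eps1; have hh1 := h1.
move=> J0 nJ.
have [M [y [M0 hM Dy gram hy]]] := crude_sample.
set D' := [set z | exists2 k, (k < M)%N & z = y k].
have DD z : D' z -> D z by move=> [k /Dy + ->].
have hE' : expectation D' setT (@avg R T M y) by exact: avg_expectation.
have JR : 0 < J%:R :> R by rewrite ltr0n.
have eh1 : eps / 2 <= 1 by lra.
have eJ4 : eps / (4 * J%:R) <= 4.
  rewrite ler_pdivrMr ?mulr_gt0 //; have : 1 <= J%:R :> R by rewrite ler1n.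
  lra.
pose L := ln (8 * M%:R) : R.
have L1 : 1 <= L by exact: ln8M_ge1.
pose w := 512 * (Lam * B) * J%:R ^+ 2 * (4108 * L + Lf + 2 * J%:R) / eps ^+ 2.
have L40 : 0 <= 4108 * L := mulr_ge0 (ler0n _ _) (le_trans ler01 L1).
have LLJ : 0 <= 4108 * L + Lf + 2 * J%:R :=
  addr_ge0 (addr_ge0 L40 Lf0) (mulr_ge0 (ler0n _ _) (ler0n _ _)).
have wJ : 0 <= 512 * (Lam * B) * J%:R ^+ 2 :=
  mulr_ge0 (mulr_ge0 (ler0n _ _) (ltW lb0)) (sqr_ge0 _).
have w0 : 0 <= w := divr_ge0 (mulr_ge0 wJ LLJ) (sqr_ge0 _).
pose m := (Num.truncn w).+1.
have wm : w < m%:R by exact: truncnS_gt.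
have FE2 c : F c -> avg M y (fun z => Phi (V z c)) <= 2.
  move=> Fc; apply: le_trans (ler_distlDr (hy c Fc)) _.
  exact: lerD (FE Fc) eh1.
have FK c : F c -> avg M y (fun z => V z c) <= K.
  move=> Fc; apply: (@le_trans _ _ (avg M y (fun z => 1 + a / Phi 1 * Phi (V z c)))).
    apply: (expect_le hE') => // z _; apply: (growth_ge_linear hP); exact: hypot_ge0.
  rewrite (expectD hE') // (expectZ hE') // (expect_cst hE') /K lerD2l mulrC.
  rewrite ler_wpM2r ?FE2 // divr_ge0 ?(growth_ge0 hP) //.
  exact: le_trans ler01 (growth_a1 hP).
have [N hN] : exists N : nat -> seq 'rV[R]_n, forall j,
    [/\ {in N j, forall c, F c}, (size (N j))%:R <= expR (2054 * L * 2 ^+ j) &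
     forall c, F c -> exists2 g, g \in N j & forall z, D' z -> V z (c - g) <= B / 2 ^+ j].
  suff H j : exists s : seq 'rV[R]_n,
    [/\ {in s, forall c, F c}, (size s)%:R <= expR (2054 * L * 2 ^+ j) &
     forall c, F c -> exists2 g, g \in s & forall z, D' z -> V z (c - g) <= B / 2 ^+ j].
    exists (fun j => projT1 (cid (H j))) => j; exact: projT2 (cid (H j)).
  have := @sample_entropy R T n p r M y F h K M0 h0 K0
    (fun z Dz => hp (DD z Dz)) (fun z Dz => hr (DD z Dz)) FK
    (fun c Fc z Dz => FB Fc (DD z Dz)) gram j.
  move/net_of_packing => [s [Fs _ ss cov]]; exists s; split => // c Fc.
  by have [g gs ng] := cov c Fc; exists g => //; exact: nfarP ng.
have [s [Fs ss cov]] := fine_net DD.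
pose A (j : nat) := if j == 0%N then [:: 0] else if (j < J)%N then N j else s.
have AF j : {in A j, forall g, F g}.
  move=> g; rewrite /A; case: eqP => _; first by rewrite inE => /eqP ->.
  by case: ltnP => _; [have [h' _ _] := hN j; exact: h'|exact: Fs].
pose X (j : nat) := if (j.+1 < J)%N then 2054 * L * 2 ^+ j.+1 else n%:R * Lf.
have tw j : 0 < 2 ^+ j :> R by rewrite exprn_gt0.
have tw1 j : 1 <= 2 ^+ j :> R by rewrite exprn_ege1 // ler1n.
have := @chaining R T D' setT (avg M y) hE' n V (modV_modulus p r) Phi q a hP F B B0
  (fun=> I) (fun c Fc z Dz => FB Fc (DD z Dz)) FE2
  A (fun j => B / 2 ^+ j) X J (eps / (4 * J%:R)) m 'I_0 (fun _ _ => 0) 0 1 1.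
case=> //.
- by rewrite divr_gt0 // mulr_gt0.
- by move=> j; rewrite divr_gt0.
- move=> j jJ g /AF Fg; case: j jJ => [|j] jJ.
    exists 0; first by rewrite /A eqxx inE.
    by move=> z Dz; rewrite subr0 expr0 divr1; apply: FB => //; exact: DD.
  have [_ _ cv] := hN j.+1; have [g' g'N hg'] := cv g Fg.
  by exists g' => //; rewrite /A /= jJ.
- move=> j jJ; rewrite /X /A /=; case: ltnP => // _.
  by have [] := hN j.+1.
- move=> j jJ.
  have key : B / 2 ^+ j * (X j + 2 * J%:R) <= B * (4108 * L + Lf + 2 * J%:R).
    rewrite mulrAC ler_pdivrMr // -[leRHS]mulrA ler_pM2l //.
    have J2 : 2 * J%:R <= 2 * J%:R * 2 ^+ j :> R by rewrite ler_peMr // mulr_ge0 // ltW.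
    have Lf2 : 0 <= Lf * 2 ^+ j by rewrite mulr_ge0 // ltW.
    have L2 : 0 <= L * 2 ^+ j := mulr_ge0 (le_trans ler01 L1) (ltW (tw j)).
    rewrite /X; case: ltnP => hj.
      have -> : (4108 * L + Lf + 2 * J%:R) * 2 ^+ j =
          2054 * L * 2 ^+ j.+1 + (Lf * 2 ^+ j + 2 * J%:R * 2 ^+ j).
        by rewrite exprS; ring.
      by rewrite lerD2l ler_wpDl.
    have jE : j = J.-1 by apply/eqP; rewrite eqn_leq -ltnS prednK // jJ -ltnS prednK.
    have nj : n%:R <= 2 ^+ j :> R by rewrite jE -natrX ler_nat.
    have nLf : n%:R * Lf <= Lf * 2 ^+ j by rewrite mulrC ler_wpM2l.
    have -> : (4108 * L + Lf + 2 * J%:R) * 2 ^+ j =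
        4108 * (L * 2 ^+ j) + (Lf * 2 ^+ j + 2 * J%:R * 2 ^+ j) by ring.
    by apply: ler_wpDl; [exact: mulr_ge0 (ler0n _ _) L2|exact: lerD].
  apply: (@le_trans _ _ (32 * Lam * (B * (4108 * L + Lf + 2 * J%:R)))).
    rewrite -[leLHS]mulrA ler_wpM2l //; apply: mulr_ge0 => //; exact: ltW.
  have -> : 32 * Lam * (B * (4108 * L + Lf + 2 * J%:R)) = w * (eps / (4 * J%:R)) ^+ 2.
    by rewrite /w; field; nz.
  by rewrite ler_wpM2r ?sqr_ge0 // ltW.
- by case.
- by case.
- by rewrite mulr0.
- by rewrite card_ord mul0r.
move=> x [Dx _ hx]; exists m, x; split => //.
- rewrite /m -natr1 lerD2r; apply: (@le_trans _ _ w); first by rewrite truncn_le.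
  have ie : 0 < (eps ^+ 2)^-1 by rewrite invr_gt0 exprn_gt0.
  rewrite /w ler_pM2r; last exact: ie.
  apply: (ler_wpM2l wJ).
  rewrite !lerD2r; apply: ler_wpM2l; first exact: ler0n.
  have MR : 0 < M%:R :> R by rewrite ltr0n.
  rewrite ler_ln ?posrE; first by rewrite ler_pM2l.
    by rewrite mulr_gt0.
  by rewrite mulr_gt0 // (lt_le_trans MR).
- by move=> k /Dx /DD.
- move=> c Fc; have [g gs hg] := cov c Fc.
  have gJ : g \in A J by rewrite /A ltnn; case: eqP J0 => [->|].
  have := hx c g _ Fc gJ hg; rewrite -/Lam.
  have -> : 2 * Lam * (eps / (8 * Lam)) = eps / 4 by field; nz.
  have -> : J%:R * (eps / (4 * J%:R)) = eps / 4 by field; nz.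
  have := hy c Fc.
  have -> : avg m x (fun z => Phi (V z c)) - E (fun z => Phi (V z c)) =
   (avg m x (fun z => Phi (V z c)) - avg M y (fun z => Phi (V z c))) +
   (avg M y (fun z => Phi (V z c)) - E (fun z => Phi (V z c))) by ring.
  move=> i1 i2; apply: le_trans (ler_normD _ _) _.
  have -> : eps = eps / 4 + eps / 4 + eps / 2 by field.
  exact: lerD.
Qed.

End Discretization.

(** * The number of points *)

Section Numeric.
Context {R : realType}.

Lemma ln2_gt0 : 0 < ln 2 :> R. Proof. by rewrite ln_gt0 //; lra. Qed.

Lemma ln_le_sub1 (x : R) : 0 < x -> ln x <= x - 1.
Proof. by move=> x0; have := expR_ge1Dx (ln x); rewrite lnK ?posrE //; lra. Qed.

Lemma ln_le_log2 (x : R) : 1 <= x -> ln x <= log2 x.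
Proof.
move=> x1; have l2 := ln2_gt0.
rewrite /log2 ler_pdivlMr // ler_piMr ?ln_ge0 //.
by have := @ln_le_sub1 2 (ltr0n R 2); lra.
Qed.

Lemma log2_ge1 (x : R) : 2 <= x -> 1 <= log2 x.
Proof.
move=> x2; rewrite /log2 ler_pdivlMr ?ln2_gt0 // mul1r ler_ln ?posrE //; lra.
Qed.

Lemma log2_le (x y : R) : 0 < x -> x <= y -> log2 x <= log2 y.
Proof.
move=> x0 xy; rewrite /log2 ler_pM2r ?invr_gt0 ?ln2_gt0 // ler_ln ?posrE //.
exact: lt_le_trans xy.
Qed.

Lemma dyadic_depth (n : nat) : (0 < n)%N -> exists J : nat,
  [/\ (0 < J)%N, (n <= 2 ^ J.-1)%N & J%:R <= 2 + log2 n%:R :> R].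
Proof.
move=> n0; have n1 : 1 <= n%:R :> R by rewrite ler1n.
have nR : 0 < n%:R :> R by rewrite ltr0n.
have l0 : 0 <= log2 n%:R :> R := divr_ge0 (ln_ge0 n1) (ltW ln2_gt0).
exists (Num.truncn (log2 n%:R : R)).+2; split => //=.
  rewrite -(ler_nat R) natrX -ler_ln ?posrE ?exprn_gt0 // lnXn //.
  have := ltW (truncnS_gt (log2 n%:R : R)); rewrite {1}/log2 ler_pdivrMr ?ln2_gt0 //.
  by rewrite mulr_natl.
by rewrite -2!natr1; have := truncn_le (log2 n%:R : R); rewrite l0; lra.
Qed.

Lemma ln_monomial_le (c z u l : R) (i j : nat) :
  1 <= c -> 1 <= z -> 1 <= u -> 1 <= l -> ln z <= l -> ln u <= l ->
  ln (c * z ^+ i * u ^+ j) <= (c + i%:R + j%:R) * l.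
Proof.
move=> c1 z1 u1 l1 lz lu; have pos (x : R) : 1 <= x -> 0 < x by exact: lt_le_trans.
have [c0 z0 u0] := And3 (pos _ c1) (pos _ z1) (pos _ u1).
rewrite lnM ?posrE ?mulr_gt0 ?exprn_gt0 // lnM ?posrE ?exprn_gt0 //.
rewrite !lnXn // -(mulr_natl (ln z)) -(mulr_natl (ln u)) !mulrDl.
apply: lerD; last by rewrite ler_wpM2l.
apply: lerD; last by rewrite ler_wpM2l.
apply: le_trans (ln_le_sub1 c0) _; apply: (@le_trans _ _ c); first by rewrite gerBl.
by rewrite ler_peMr // ltW.
Qed.

Lemma crude_size_le (c1 c2 v z u LB k Lf : R) (q : nat) :
  0 <= c1 -> 0 <= c2 -> 0 <= v -> 1 <= z -> 1 <= u -> 0 <= k -> k <= 2 * z ->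
  0 <= LB -> LB <= v * z ^+ q -> 0 <= Lf -> Lf <= 64 * v * z ^+ q.+1 * u ->
  c1 * LB * (k * Lf + 2) * u ^+ 2 + c2 * (k ^+ 4 * z ^+ 2) + 1 <=
    (c1 * v * (128 * v + 2) + 16 * c2 + 1) * z ^+ (2 * q + 6) * u ^+ 3.
Proof.
move=> c10 c20 v0 z1 u1 k0 kz LB0 hLB Lf0 hLf.
have z0 : 0 < z by exact: lt_le_trans z1.
have u0 : 0 < u by exact: lt_le_trans u1.
have zu i j : 1 <= z ^+ i * u ^+ j.
  by rewrite -[1]mulr1; apply: ler_pM => //; exact: exprn_ege1.
have kLf : k * Lf + 2 <= (128 * v + 2) * z ^+ q.+2 * u.
  have -> : (128 * v + 2) * z ^+ q.+2 * u =
      2 * z * (64 * v * z ^+ q.+1 * u) + 2 * (z ^+ q.+2 * u ^+ 1).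
    by rewrite [z ^+ q.+2]exprS expr1; ring.
  by apply: lerD; [exact: ler_pM|rewrite ler_peMr].
have v20 : 0 <= 128 * v + 2 := addr_ge0 (mulr_ge0 (ler0n _ _) v0) (ler0n _ _).
have -> : (c1 * v * (128 * v + 2) + 16 * c2 + 1) * z ^+ (2 * q + 6) * u ^+ 3 =
    c1 * v * (128 * v + 2) * (z ^+ (2 * q + 6) * u ^+ 3) +
    c2 * (16 * (z ^+ (2 * q + 6) * u ^+ 3)) + z ^+ (2 * q + 6) * u ^+ 3.
  by move: (z ^+ _) (u ^+ 3) => s t; ring.
apply: lerD (zu _ _); apply: lerD.
  apply: (@le_trans _ _ (c1 * (v * z ^+ q) * ((128 * v + 2) * z ^+ q.+2 * u) * u ^+ 2)).
    apply: ler_pM => //; first exact: mulr_ge0 (mulr_ge0 c10 LB0) (addr_ge0 (mulr_ge0 k0 Lf0) _).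
      exact: sqr_ge0.
    apply: ler_pM => //; first exact: mulr_ge0.
      exact: addr_ge0 (mulr_ge0 k0 Lf0) _.
    exact: ler_wpM2l.
  have -> : c1 * (v * z ^+ q) * ((128 * v + 2) * z ^+ q.+2 * u) * u ^+ 2 =
     c1 * v * (128 * v + 2) * (z ^+ (2 * q + 2) * u ^+ 3).
    have -> : (2 * q + 2 = q + q.+2)%N by rewrite mul2n -addnn !addnS addn0.
    by rewrite exprD; move: (z ^+ q) (z ^+ q.+2) => s t; ring.
  apply: ler_wpM2l; first exact: mulr_ge0 (mulr_ge0 c10 v0) v20.
  by rewrite ler_wpM2r ?exprn_ge0 ?(ltW u0) // ler_weXn2l // leq_add2l.
rewrite ler_wpM2l //.
apply: (@le_trans _ _ ((2 * z) ^+ 4 * z ^+ 2)).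
  rewrite ler_wpM2r ?exprn_ge0 ?(ltW z0) // lerXn2r ?nnegrE //.
  exact: le_trans kz.
have -> : (2 * z) ^+ 4 * z ^+ 2 = 16 * z ^+ 6 by ring.
rewrite ler_pM2l //; apply: (@le_trans _ _ (z ^+ (2 * q + 6))).
  by rewrite ler_weXn2l // leq_addl.
by rewrite ler_peMr ?exprn_ge0 ?(ltW z0) // exprn_ege1.
Qed.

(** Every logarithm is at most a constant times log2 (1 / eps) * log2 (2 z), because
    both factors are at least 1 and n <= 2 z; the depth J is at most
    3 log2 (2 N). *)
Lemma sample_size_bound (c1 c2 c3 w phi1 : R) (q : nat) :
  0 <= c1 -> 0 <= c2 -> 0 <= c3 -> 0 <= w -> 0 < phi1 ->
  exists2 C : R, 0 < C & forall (n N J : nat) (z eps LB P Lf Mb : R),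
    1 <= z -> 0 < eps -> eps <= 1 / 2 -> (0 < n)%N -> (0 < N)%N ->
    n%:R <= 2 * z -> n%:R <= 2 * N%:R :> R -> J%:R <= 2 + log2 n%:R :> R ->
    0 <= LB -> LB <= w * P -> phi1 <= P -> P <= phi1 * z ^+ q ->
    Lf = ln (32 * LB * n%:R / eps + 1) ->
    Mb = c1 * LB * (n%:R * Lf + 2) / eps ^+ 2 + c2 * (n%:R ^+ 4 * z ^+ 2) + 1 ->
    c1 * LB * J%:R ^+ 2 * (c3 * ln (8 * Mb) + Lf + 2 * J%:R) / eps ^+ 2 + 1
    <= C * eps ^- 2 * log2 (eps^-1) * P * log2 (2 * N%:R) ^+ 2 * log2 (2 * z).
Proof.
move=> c10 c20 c30 w0 p0.
pose v := w * phi1; have v0 : 0 <= v by exact: mulr_ge0 w0 (ltW p0).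
pose Cf := 64 * v + 1 + q.+1%:R + 1%:R.
pose W := c1 * v * (128 * v + 2) + 16 * c2 + 1.
have W1 : 1 <= W.
  rewrite /W lerDr; apply: addr_ge0; last exact: mulr_ge0.
  exact: mulr_ge0 (mulr_ge0 c10 v0) (addr_ge0 (mulr_ge0 (ler0n _ _) v0) (ler0n _ _)).
pose Cm := 8 * W + (2 * q + 6)%:R + 3%:R.
have Cm0 : 0 <= Cm.
  by do 2!apply: addr_ge0 => //; apply: mulr_ge0 => //; exact: le_trans W1.
have Cf0 : 0 <= Cf by do 3!apply: addr_ge0 => //; exact: mulr_ge0.
pose Cs := c3 * Cm + Cf + 6.
have Cs0 : 0 <= Cs by do 2!apply: addr_ge0 => //; exact: mulr_ge0.
exists (9 * c1 * w * Cs + phi1^-1).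
  rewrite ltr_wpDl ?invr_gt0 //; apply: mulr_ge0 => //.
  by apply: mulr_ge0 => //; exact: mulr_ge0.
move=> n N J z eps LB P Lf Mb z1 e0 e1 n0 N0 nz nN hJ LB0 hLB hP1 hP2 hLf hMb.
pose u := eps^-1.
have u2 : 2 <= u by rewrite -[2]invrK lef_pV2 ?posrE ?invr_gt0 //; lra.
have u1 : 1 <= u by apply: le_trans u2; rewrite ler1n.
have u0 : 0 < u by rewrite invr_gt0.
have nR : 1 <= n%:R :> R by rewrite ler1n.
have nR0 : 0 < n%:R :> R by rewrite ltr0n.
have two x : 1 <= x -> 2 <= 2 * x :> R by move=> x1; rewrite ler_peMr.
have P0 : 0 < P by exact: lt_le_trans hP1.
have z0 : 0 < z by exact: lt_le_trans z1.
set le := log2 eps^-1; set lh := log2 (2 * z); set lN := log2 (2 * N%:R).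
have le1 : 1 <= le by exact: log2_ge1.
have lh1 : 1 <= lh by exact: log2_ge1 (two _ z1).
have lN1 : 1 <= lN by apply: log2_ge1; apply: two; rewrite ler1n.
pose l := le * lh.
have l_e : le <= l by rewrite /l ler_peMr // (le_trans ler01).
have l_h : lh <= l by rewrite /l ler_peMl // (le_trans ler01).
have l1 : 1 <= l by exact: le_trans l_e.
have lnz : ln z <= l.
  apply: le_trans l_h; apply: (@le_trans _ _ (ln (2 * z))).
    by rewrite ler_ln ?posrE ?mulr_gt0 // ler_peMl ?(ltW z0) // ler1n.
  by apply: ln_le_log2; apply: le_trans (two _ z1); rewrite ler1n.
have lnu : ln u <= l by apply: le_trans l_e; exact: ln_le_log2.
have hLBz : LB <= v * z ^+ q.
  by apply: le_trans hLB _; rewrite /v -mulrA; exact: ler_wpM2l.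
have x0 : 0 <= 32 * LB * n%:R / eps.
  exact: divr_ge0 (mulr_ge0 (mulr_ge0 (ler0n _ _) LB0) (ltW nR0)) (ltW e0).
have hx : 32 * LB * n%:R / eps <= 64 * v * z ^+ q.+1 * u.
  rewrite ler_pM2r //.
  apply: (@le_trans _ _ (32 * (v * z ^+ q) * (2 * z))).
    by apply: ler_pM => //; [exact: mulr_ge0|rewrite ler_pM2l].
  by rewrite exprSr le_eqVlt; apply/orP; left; apply/eqP; ring.
have x1 : 0 < 32 * LB * n%:R / eps + 1 by exact: ltr_wpDl.
have Lf0 : 0 <= Lf by rewrite hLf ln_ge0 // lerDr.
have Lfx : Lf <= 64 * v * z ^+ q.+1 * u.
  by apply: le_trans hx; rewrite hLf; apply: le_trans (ln_le_sub1 x1) _; rewrite addrK.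
have hLfl : Lf <= Cf * l.
  have v1 : 1 <= 64 * v + 1 by rewrite lerDr mulr_ge0.
  apply: le_trans (ln_monomial_le q.+1 1 v1 z1 u1 l1 lnz lnu).
  have zu : 1 <= z ^+ q.+1 * u ^+ 1.
    by rewrite -[1]mulr1; apply: ler_pM => //; exact: exprn_ege1.
  rewrite hLf ler_ln ?posrE //; last by rewrite -mulrA mulr_gt0 // (lt_le_trans ltr01).
  have -> : (64 * v + 1) * z ^+ q.+1 * u ^+ 1 =
      64 * v * z ^+ q.+1 * u + z ^+ q.+1 * u ^+ 1.
    by rewrite expr1; move: (z ^+ q.+1) => s; ring.
  exact: lerD.
have Mb1 : 1 <= Mb.
  rewrite hMb lerDr; apply: addr_ge0.
    exact: divr_ge0 (mulr_ge0 (mulr_ge0 c10 LB0)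
      (addr_ge0 (mulr_ge0 (ler0n _ _) Lf0) (ler0n R 2))) (sqr_ge0 eps).
  exact: mulr_ge0 c20 (mulr_ge0 (exprn_ge0 4 (ler0n _ _)) (sqr_ge0 z)).
have eight (x : R) : 1 <= x -> 1 <= 8 * x.
  move=> hx1; apply: (le_trans hx1); apply: ler_peMl; last by rewrite ler1n.
  exact: le_trans hx1.
have Mb8 : 1 <= 8 * Mb by exact: eight.
have MbW : Mb <= W * z ^+ (2 * q + 6) * u ^+ 3.
  rewrite hMb -exprVn; exact: (crude_size_le c10 c20 v0 z1 u1 (ltW nR0) nz LB0 hLBz Lf0 Lfx).
have lnMb : ln (8 * Mb) <= Cm * l.
  have W8 : 1 <= 8 * W by exact: eight.
  apply: le_trans (ln_monomial_le (2 * q + 6) 3 W8 z1 u1 l1 lnz lnu).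
  rewrite -2!mulrA ler_ln ?posrE; last 2 first.
  - exact: lt_le_trans Mb8.
  - have W0 : 0 < W by exact: lt_le_trans W1.
    by do 2!apply: mulr_gt0 => //; rewrite ?mulr_gt0 ?exprn_gt0.
  by rewrite ler_pM2l // mulrA.
have l3 (x : R) : 1 <= x -> log2 n%:R <= x -> J%:R <= 3 * x.
  move=> x1' hnx; apply: le_trans hJ _.
  have -> : 3 * x = 2 * x + x by ring.
  by apply: lerD => //; rewrite ler_peMr.
have Jl : J%:R <= 3 * l by apply: l3 l1 _; apply: le_trans l_h; exact: log2_le.
have JN : J%:R <= 3 * lN by apply: l3 => //; exact: log2_le.
have J2 : J%:R ^+ 2 <= 9 * lN ^+ 2.
  have -> : 9 * lN ^+ 2 = (3 * lN) ^+ 2 by ring.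
  by rewrite lerXn2r ?nnegrE // (le_trans _ JN).
have sumle : c3 * ln (8 * Mb) + Lf + 2 * J%:R <= Cs * l.
  have -> : Cs * l = c3 * (Cm * l) + Cf * l + 2 * (3 * l) by rewrite /Cs; ring.
  apply: lerD; last by rewrite ler_pM2l.
  by apply: lerD hLfl; exact: ler_wpM2l.
have sum0 : 0 <= c3 * ln (8 * Mb) + Lf + 2 * J%:R.
  exact: addr_ge0 (addr_ge0 (mulr_ge0 c30 (ln_ge0 Mb8)) Lf0) (mulr_ge0 (ler0n _ _) (ler0n _ _)).
have ie2' : 0 < eps ^- 2 by rewrite invr_gt0 exprn_gt0.
have T1 : c1 * LB * J%:R ^+ 2 * (c3 * ln (8 * Mb) + Lf + 2 * J%:R) / eps ^+ 2 <=
   c1 * (w * P) * (9 * lN ^+ 2) * (Cs * l) / eps ^+ 2.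
  apply: ler_wpM2r; first exact: ltW.
  apply: ler_pM => //; first exact: mulr_ge0 (mulr_ge0 c10 LB0) (sqr_ge0 _).
  by apply: ler_pM => //; [exact: mulr_ge0|exact: ler_wpM2l].
have T2 : 1 <= phi1^-1 * (P * (eps ^- 2 * l * lN ^+ 2)).
  rewrite ler_pdivlMl // mulr1; apply: le_trans hP1 _.
  rewrite ler_peMr ?(ltW P0) //.
  have mul1 (x y : R) : 1 <= x -> 1 <= y -> 1 <= x * y.
    by move=> hx1 hy1; rewrite -[1]mulr1; exact: ler_pM.
  have e2 : 1 <= eps ^- 2 by rewrite -exprVn; exact: exprn_ege1.
  exact: mul1 (mul1 _ _ e2 l1) (exprn_ege1 2 lN1).
apply: le_trans (lerD T1 T2) _.
by rewrite /l le_eqVlt; apply/orP; left; apply/eqP; ring.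
Qed.

End Numeric.

(** * Integration over a compact set *)

Section CompactIntegration.
Context {R : realType} {d : nat} (Omega : set 'rV[R]_d) (cO : compact Omega).

Definition cont_on (f : 'rV[R]_d -> R) : Prop := {within Omega, continuous f}.

Lemma borel_open (U : set 'rV[R]_d) : open U ->
  measurable (U : set (borel_space R d)).
Proof. by move=> oU; exact: sub_sigma_algebra. Qed.

Lemma borel_compact : measurable (Omega : set (borel_space R d)).
Proof.
have /closed_openC/borel_open/measurableC : closed Omega.
  by apply: compact_closed => //; exact: norm_hausdorff.
by rewrite setCK.
Qed.

Lemma cont_on_measurable (f : borel_space R d -> R) : cont_on f ->
  measurable_fun (Omega : set (borel_space R d)) f.
Proof.
move=> /continuousP cf; apply: (measurability _ (RGenOInfty.measurableE R)).
move=> _ [_ [a ->] <-].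
have /cf/open_subspaceP[U oU UO] : open (`]a, +oo[%classic : set R).
  exact: interval_open.
rewrite setIC -UO; apply: measurableI; [exact: borel_open|exact: borel_compact].
Qed.

Lemma cont_on_comp (f : 'rV[R]_d -> R) (g : R -> R) :
  continuous g -> cont_on f -> cont_on (g \o f).
Proof.
move=> cg cf x; apply: (@continuous_comp (subspace Omega) R R f g).
  exact: cf.
exact: cg.
Qed.

Lemma cont_onD f g : cont_on f -> cont_on g -> cont_on (fun x => f x + g x).
Proof. by move=> cf cg x; apply: cvgD; [exact: cf|exact: cg]. Qed.

Lemma cont_onM f g : cont_on f -> cont_on g -> cont_on (fun x => f x * g x).
Proof. by move=> cf cg x; apply: cvgM; [exact: cf|exact: cg]. Qed.

Lemma cont_on_cst a : cont_on (fun=> a).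
Proof. by move=> x; exact: cvg_cst. Qed.

Lemma cont_on_bounded f : cont_on f -> exists b : R, forall x, Omega x -> `|f x| <= b.
Proof.
move=> cf; have /compact_bounded[b [_ hb]] := continuous_compact cf cO.
by exists (b + 1) => x Ox; apply: hb; [rewrite ltrDl|exists x].
Qed.

Variable mu : probability (borel_space R d) R.
Hypothesis muO : mu Omega = 1%E.

Lemma cont_on_integrable f : cont_on f -> mu.-integrable Omega (EFin \o f).
Proof.
move=> cf; apply: measurable_bounded_integrable.
- exact: borel_compact.
- by have := ltry (1 : R); rewrite -muO.
- exact: cont_on_measurable.
- have [b hb] := cont_on_bounded cf.
  exists b; split; first exact: num_real.
  by move=> x bx y Oy; exact: le_trans (hb y Oy) (ltW bx).
Qed.

Lemma integral_expectation :
  expectation Omega cont_on (fun f => \int[mu]_(x in Omega) f x).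
Proof.
have mO := borel_compact.
split.
- exact: cont_on_cst.
- exact: cont_onD.
- exact: cont_onM.
- by move=> f cf; apply: (cont_on_comp _ cf); exact: continuous_expR.
- move=> a; rewrite Rintegral_cst //.
  by have := congr1 fine muO => /= ->; rewrite mulr1.
- by move=> f g cf cg; rewrite RintegralD //; exact: cont_on_integrable.
- by move=> a f cf; rewrite RintegralZl //; exact: cont_on_integrable.
- move=> f g cf cg fg.
  exact: (le_Rintegral mO (cont_on_integrable cf) (cont_on_integrable cg) fg).
Qed.

Lemma integral_cont_on f : cont_on f ->
  (\int[mu]_(x in Omega) (f x)%:E)%E = (\int[mu]_(x in Omega) f x)%:E.
Proof.
move=> cf; rewrite /Rintegral fineK //; apply: integrable_fin_num => //.
  exact: borel_compact.
exact: cont_on_integrable.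
Qed.

Lemma integral_empirical (m : nat) (x : nat -> borel_space R d) f :
  cont_on f -> (forall y, Omega y -> 0 <= f y) -> (forall j, (j < m)%N -> Omega (x j)) ->
  (\int[empirical_measure m x]_(y in Omega) (f y)%:E)%E = (avg m x f)%:E.
Proof.
move=> cf f0 xO; have mO := borel_compact.
have mf : measurable_fun (Omega : set (borel_space R d)) (EFin \o f).
  by apply/measurable_EFinP; exact: cont_on_measurable.
rewrite /empirical_measure ge0_integral_mscale //=.
rewrite ge0_integral_measure_sum //.
rewrite /avg EFinM; congr (_ * _)%E; rewrite -sumEFin; apply: eq_bigr => j _.
rewrite integral_dirac //= diracE mem_set ?mul1e //.
exact: xO.
Qed.

End CompactIntegration.

(** The absolute value confines the argument to [0, oo), the domain on which Phi is
    meaningful. *)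
Lemma growth_continuous {R : realType} (Phi : R -> R) (q : nat) (a : R) :
  regular_growth Phi q a -> continuous (fun t : R => Phi `|t|).
Proof.
move=> hP t; apply/cvgrPdist_lt => e e0.
pose B := `|t| + 1.
have B0 : 0 < B by rewrite /B; have := normr_ge0 t; lra.
have L0 := growth_lip_gt0 hP B0.
have h1 : \forall s \near t, ball t 1 s by exact: nbhsx_ballx.
have h2 : \forall s \near t, ball t (e / @growth_lip R Phi q a B) s.
  by apply: nbhsx_ballx; rewrite divr_gt0.
near=> s.
have b1 : ball t 1 s by near: s.
have b2 : ball t (e / @growth_lip R Phi q a B) s by near: s.
rewrite /ball /= in b1 b2.
have sB : `|s| <= B.
  rewrite /B; have := lerB_dist s t; rewrite distrC; lra.
have tB : `|t| <= B by rewrite /B; lra.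
apply: le_lt_trans (growth_lip_abs hP (normr_ge0 t) (normr_ge0 s) tB sB B0) _.
rewrite mulrC -ltr_pdivlMr //; apply: le_lt_trans b2.
exact: ler_dist_dist.
Unshelve. all: by end_near.
Qed.

Section ContModulus.
Context {R : realType} {d : nat} (Omega : set 'rV[R]_d).

Lemma cont_on_sum (I : Type) (s : seq I) (f : I -> 'rV[R]_d -> R) :
  (forall i, cont_on Omega (f i)) -> cont_on Omega (fun x => \sum_(i <- s) f i x).
Proof.
move=> cf; elim: s => [|i s ih].
  by under eq_fun do rewrite big_nil; exact: cont_on_cst.
by under eq_fun do rewrite big_cons; exact: cont_onD.
Qed.

Lemma cont_on_lincomb n (u : 'I_n -> 'rV[R]_d -> R) c :
  (forall i, cont_on Omega (u i)) -> cont_on Omega (fun x => lincomb u x c).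
Proof.
move=> cu; apply: cont_on_sum => i; apply: cont_onM; last exact: cu.
exact: cont_on_cst.
Qed.

Lemma cont_on_modV n (p r : 'I_n -> 'rV[R]_d -> R) c :
  (forall i, cont_on Omega (p i)) -> (forall i, cont_on Omega (r i)) ->
  cont_on Omega (fun x => modV p r x c).
Proof.
move=> cp cr.
have c1 := cont_on_lincomb (c := c) cp; have c2 := cont_on_lincomb (c := c) cr.
apply: (@cont_on_comp _ _ _ (fun x => lincomb p x c ^+ 2 + lincomb r x c ^+ 2) Num.sqrt).
  exact: sqrt_continuous.
by apply: cont_onD; under eq_fun do rewrite expr2; exact: cont_onM.
Qed.

Lemma cont_on_growth n (p r : 'I_n -> 'rV[R]_d -> R) c (Phi : R -> R) (q : nat) (a : R) :
  regular_growth Phi q a ->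
  (forall i, cont_on Omega (p i)) -> (forall i, cont_on Omega (r i)) ->
  cont_on Omega (fun x => Phi (modV p r x c)).
Proof.
move=> hP cp cr.
have -> : (fun x => Phi (modV p r x c)) = (fun t : R => Phi `|t|) \o (fun x => modV p r x c).
  by apply/funext => x /=; rewrite ger0_norm // hypot_ge0.
by apply: cont_on_comp; [exact: growth_continuous hP|exact: cont_on_modV].
Qed.

End ContModulus.

(** Induction through the Schur complement of the upper left entry, which inherits
    symmetry and positivity. *)
Lemma gram_orthonormal {R : realType} n (G : 'M[R]_n) :
  G^T = G -> (forall v : 'rV[R]_n, v != 0 -> 0 < (v *m G *m v^T) 0 0) ->
  exists2 A : 'M[R]_n, A \in unitmx & A *m G *m A^T = 1%:M.
Proof.
elim: n G => [|n ih] G Gs Gp.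
  by exists 1%:M; [exact: unitmx1|apply/matrixP => -[]].
suff [A hA] : exists A : 'M[R]_(1 + n), A *m G *m A^T = 1%:M.
  exists A => //; move: (hA); rewrite -mulmxA => /mulmx1_unit[] //.
move: G Gs Gp; rewrite -[n.+1]/(1 + n)%N => G Gs Gp.
pose b := ursubmx G; pose D := drsubmx G; pose g := ulsubmx G 0 0.
have gE : ulsubmx G = g%:M by rewrite [LHS]mx11_scalar.
have bE : dlsubmx G = b^T by rewrite /b trmx_ursub Gs.
have DE : D^T = D by rewrite /D trmx_drsub Gs.
have GE : G = block_mx g%:M b b^T D by rewrite -gE -bE submxK.
have g0 : 0 < g.
  have := Gp (row_mx 1%:M 0); rewrite GE.
  have -> : row_mx 1%:M 0 *m block_mx g%:M b b^T D *m (row_mx 1%:M 0)^T = g%:M :> 'M[R]_1.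
    rewrite tr_row_mx mul_row_block mul_row_col !mul1mx !mul0mx !addr0.
    by rewrite trmx0 mulmx0 addr0 trmx1 mulmx1.
  rewrite mxE eqxx mulr1n; apply; apply/eqP => /(congr1 lsubmx).
  by rewrite row_mxKl linear0 => /matrixP/(_ 0 0)/eqP; rewrite !mxE oner_eq0.
pose S : 'M[R]_n := D - g^-1 *: (b^T *m b).
have Ss : S^T = S by rewrite /S linearB linearZ /= trmx_mul trmxK DE.
have Sp (v : 'rV[R]_n) : v != 0 -> 0 < (v *m S *m v^T) 0 0.
  move=> v0; have := Gp (row_mx (- g^-1 *: (v *m b^T)) v).
  have -> : row_mx (- g^-1 *: (v *m b^T)) v *m G *m (row_mx (- g^-1 *: (v *m b^T)) v)^T
     = v *m S *m v^T.
    rewrite GE tr_row_mx mul_row_block mul_row_col.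
    have -> : - g^-1 *: (v *m b^T) *m g%:M + v *m b^T = 0.
      by rewrite mul_mx_scalar scalerA mulrN mulfV ?gt_eqF // scaleN1r addNr.
    rewrite mul0mx add0r; congr (_ *m _).
    by rewrite /S mulmxBr addrC -scalemxAl scaleNr -mulmxA -scalemxAr.
  apply; apply: contra v0 => /eqP/(congr1 rsubmx).
  by rewrite row_mxKr linear0 => ->.
have [A Au hA] := ih S Ss Sp.
exists (block_mx ((Num.sqrt g)^-1)%:M 0 (- g^-1 *: (A *m b^T)) A).
have s0 : 0 < Num.sqrt g by rewrite sqrtr_gt0.
have sg : Num.sqrt g ^+ 2 = g by rewrite sqr_sqrtr // ltW.
rewrite GE tr_block_mx mulmx_block.
rewrite !mul0mx !addr0.
have -> : - g^-1 *: (A *m b^T) *m g%:M + A *m b^T = 0.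
  by rewrite mul_mx_scalar scalerA mulrN mulfV ?gt_eqF // scaleN1r addNr.
have -> : - g^-1 *: (A *m b^T) *m b + A *m D = A *m S.
  by rewrite /S mulmxBr addrC -scalemxAl scaleNr -mulmxA -scalemxAr.
rewrite mulmx_block !mul0mx !add0r !trmx0 !mulmx0 !addr0 hA.
rewrite tr_scalar_mx.
have -> : (Num.sqrt g)^-1%:M *m g%:M *m (Num.sqrt g)^-1%:M = 1%:M :> 'M[R]_1.
  rewrite -!scalar_mxM; congr (_%:M); rewrite -{2}sg; field; by rewrite gt_eqF.
have -> : (Num.sqrt g)^-1%:M *m g%:M *m (- g^-1 *: (A *m b^T))^T +
    (Num.sqrt g)^-1%:M *m b *m A^T = 0.
  rewrite linearZ /= trmx_mul trmxK -mulmxA [g%:M *m _]mul_scalar_mx scalerA.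
  by rewrite mulrN mulfV ?gt_eqF // scaleN1r mulmxN mulmxA addNr.
by rewrite -scalar_mx_block.
Qed.

(** * Real orthonormal coordinates *)

Lemma subspace_sum {R : realType} {d : nat} {K : numFieldType} (Omega : set 'rV[R]_d)
    (N : nat) (X : set ('rV[R]_d -> K)) (I : Type) (s : seq I) (c : I -> K)
    (b : I -> 'rV[R]_d -> K) :
  subspace_of_C Omega N X -> (forall i, X (b i)) ->
  X (fun x => \sum_(i <- s) c i * b i x).
Proof.
move=> hX hb; elim: s => [|i s ih].
  by under eq_fun do rewrite big_nil; exact: subspace0 hX.
by under eq_fun do rewrite big_cons; apply: (subspace_linear hX).
Qed.

(** X in n real coordinates: p and r are the real and the imaginary parts of a basis
    of X over the reals. *)
Definition real_model {R : realType} {d : nat} {K : numFieldType} (nrm : K -> R)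
    (Omega : set 'rV[R]_d) (X : set ('rV[R]_d -> K)) (n : nat)
    (p r : 'I_n -> 'rV[R]_d -> R) : Prop :=
  [/\ forall i, cont_on Omega (p i), forall i, cont_on Omega (r i),
      forall f, X f -> exists c, forall x, Omega x -> nrm (f x) = modV p r x c,
      forall c, exists2 f, X f & forall x, Omega x -> nrm (f x) = modV p r x c
    & forall c, (forall x, Omega x -> modV p r x c = 0) -> c = 0].

Lemma real_model_real {R : realType} {d : nat} (Omega : set 'rV[R]_d) (N : nat)
    (X : set ('rV[R]_d -> (R : numFieldType))) :
  subspace_of_C Omega N X ->
  exists p r : 'I_N -> 'rV[R]_d -> R, real_model (fun x : R => `|x|) Omega X p r.
Proof.
move=> hX; have [b [Xb indep span]] := subspace_basis hX.
exists b, (fun _ _ => 0).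
have E x c : modV b (fun _ _ => 0) x c = `|\sum_i c 0 i * b i x|.
  rewrite /modV {2}/lincomb big1 ?hypot0 // => i _; exact: mulr0.
split.
- by move=> i; exact: subspace_continuous hX _ (Xb i).
- by move=> i; exact: cont_on_cst.
- move=> f /span[c hc]; exists (\row_i c i) => x Ox; rewrite E hc //.
  by congr `| _ |; apply: eq_bigr => i _; rewrite mxE.
- move=> c; exists (fun x => \sum_i c 0 i * b i x); last by move=> x _; rewrite E.
  exact: (@subspace_sum _ _ _ Omega N X _ _ (fun i => c 0 i) b hX Xb).
- move=> c hc; apply/rowP => i; rewrite mxE; apply: (indep (fun i => c 0 i)).
  by move=> x Ox; apply/eqP; rewrite -normr_eq0 -E hc.
Qed.

Lemma cont_on_coordinate {R : realType} {d : nat} (Omega : set 'rV[R]_d)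
    (f : 'rV[R]_d -> (R[i] : numFieldType)) (u : R[i] -> R) :
  (forall z w, u z - u w = u (z - w)) -> (forall z, `|u z|%:C%C <= `|z|) ->
  {within Omega, continuous f} -> cont_on Omega (u \o f).
Proof.
move=> uB ule cf x; apply/cvgrPdist_lt => e e0.
have e0C : 0 < e%:C%C :> R[i] by rewrite ltcR.
have /cvgrPdist_lt/(_ _ e0C) := cf x.
apply: filterS => y hy /=; rewrite uB -ltcR; apply: le_lt_trans hy; exact: ule.
Qed.

(** The functions b_i and 'i * b_i form a basis over the reals; the latter have real
    part - Im b_i and imaginary part Re b_i. *)
Lemma real_model_complex {R : realType} {d : nat} (Omega : set 'rV[R]_d) (N : nat)
    (X : set ('rV[R]_d -> (R[i] : numFieldType))) :
  subspace_of_C Omega N X ->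
  exists p r : 'I_(N + N) -> 'rV[R]_d -> R,
    real_model (@ComplexField.Normc.normc R) Omega X p r.
Proof.
move=> hX; have [b [Xb indep span]] := subspace_basis hX.
pose p (j : 'I_(N + N)) x := match fintype.split j with
  | inl i => complex.Re (b i x) | inr i => - complex.Im (b i x) end.
pose r (j : 'I_(N + N)) x := match fintype.split j with
  | inl i => complex.Im (b i x) | inr i => complex.Re (b i x) end.
pose cc (c : 'rV[R]_(N + N)) (i : 'I_N) : R[i] :=
  (c 0 (lshift N i) +i* c 0 (rshift N i))%C.
have reD (z w : R[i]) : complex.Re (z + w) = complex.Re z + complex.Re w by case: z; case: w.
have imD (z w : R[i]) : complex.Im (z + w) = complex.Im z + complex.Im w by case: z; case: w.
have reS c x : complex.Re (\sum_i cc c i * b i x) = lincomb p x c.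
  rewrite /lincomb big_split_ord /= (big_morph _ reD (erefl : complex.Re (0 : R[i]) = 0)).
  rewrite -big_split /=; apply: eq_bigr => i _; rewrite /p /cc.
  rewrite (unsplitK (inl i)) (unsplitK (inr i)).
  by case: (b i x) => u v /=; rewrite mulrN.
have imS c x : complex.Im (\sum_i cc c i * b i x) = lincomb r x c.
  rewrite /lincomb big_split_ord /= (big_morph _ imD (erefl : complex.Im (0 : R[i]) = 0)).
  rewrite -big_split /=; apply: eq_bigr => i _; rewrite /r /cc.
  rewrite (unsplitK (inl i)) (unsplitK (inr i)).
  by case: (b i x) => u v /=.
have E x c : ComplexField.Normc.normc (\sum_i cc c i * b i x) = modV p r x c.
  by rewrite /modV -reS -imS; case: (\sum_i _).
have cRe i : cont_on Omega (fun x => complex.Re (b i x)).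
  apply: (cont_on_coordinate (u := @complex.Re R) _ _ (subspace_continuous hX (Xb i))).
    by case=> ? ? [].
  exact: normc_ge_Re.
have cIm i : cont_on Omega (fun x => complex.Im (b i x)).
  apply: (cont_on_coordinate (u := @complex.Im R) _ _ (subspace_continuous hX (Xb i))).
    by case=> ? ? [].
  case=> u v; rewrite normc_def lecR /= -sqrtr_sqr ler_wsqrtr // lerDr; exact: sqr_ge0.
exists p, r; split.
- move=> j; rewrite /p; case: (fintype.split j) => i; first exact: cRe.
  by under eq_fun do rewrite -mulN1r; apply: cont_onM; [exact: cont_on_cst|exact: cIm].
- by move=> j; rewrite /r; case: (fintype.split j) => i; [exact: cIm|exact: cRe].
- move=> f /span[c hc].
  pose c' : 'rV[R]_(N + N) := \row_j match fintype.split j with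
    | inl i => complex.Re (c i) | inr i => complex.Im (c i) end.
  exists c' => x Ox; rewrite -E hc //; congr (ComplexField.Normc.normc _).
  apply: eq_bigr => i _; congr (_ * _); rewrite /cc /c' !mxE.
  by rewrite (unsplitK (inl i)) (unsplitK (inr i)); case: (c i).
- move=> c; exists (fun x => \sum_i cc c i * b i x); last by move=> x _; rewrite E.
  exact: (@subspace_sum _ _ _ Omega N X _ _ (cc c) b hX Xb).
- move=> c hc.
  have c0 := indep (cc c).
  have {}c0 i : cc c i = 0.
    apply: c0 => x Ox; apply: ComplexField.Normc.eq0_normc; rewrite E; exact: hc.
  apply/rowP => j; rewrite mxE -(splitK j).
  case: (fintype.split j) => i /=; have := c0 i => /eqP;
    by rewrite eq_complex /= => /andP[/eqP ? /eqP ?].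
Qed.

Section Orthonormalize.
Context {R : realType} {d : nat} (Omega : set 'rV[R]_d) (cO : compact Omega).
Context (mu : probability (borel_space R d) R) (muO : mu Omega = 1%E) (H : R).
Local Notation E f := (\int[mu]_(x in Omega) f x).

Definition nikolskii_model n (p r : 'I_n -> 'rV[R]_d -> R) :=
  forall c x, Omega x -> modV p r x c <= H * Num.sqrt (E (fun y => modV p r y c ^+ 2)).

(** By the Nikolskii inequality a function of zero L^2 norm vanishes on Omega, so
    that the Gram matrix is positive definite. *)
Lemma orthonormal_model n (p r : 'I_n -> 'rV[R]_d -> R) :
  (forall i, cont_on Omega (p i)) -> (forall i, cont_on Omega (r i)) ->
  (forall c, (forall x, Omega x -> modV p r x c = 0) -> c = 0) ->
  nikolskii_model p r ->
  exists p' r' : 'I_n -> 'rV[R]_d -> R,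
  [/\ forall i, cont_on Omega (p' i), forall i, cont_on Omega (r' i),
      forall i j, E (fun y => p' i y * p' j y + r' i y * r' j y) = (i == j)%:R,
      nikolskii_model p' r' &
      forall c, exists c', forall x, modV p r x c = modV p' r' x c'].
Proof.
move=> cp cr def nik.
have hE := integral_expectation cO muO.
pose psi (p r : 'I_n -> 'rV[R]_d -> R) i j y := p i y * p j y + r i y * r j y.
have cpsi i j : cont_on Omega (psi p r i j) by apply: cont_onD; exact: cont_onM.
pose G : 'M[R]_n := \matrix_(i, j) E (psi p r i j).
have quad (A B : 'rV[R]_n) :
    (A *m G *m B^T) 0 0 = \sum_i \sum_j A 0 i * B 0 j * E (psi p r i j).
  rewrite mxE; under eq_bigr do rewrite !mxE mulr_suml.
  rewrite exchange_big; apply: eq_bigr => i _; apply: eq_bigr => j _.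
  by rewrite !mxE mulrAC.
have lin2 (A B : 'rV[R]_n) y : \sum_i \sum_j A 0 i * B 0 j * psi p r i j y =
    lincomb p y A * lincomb p y B + lincomb r y A * lincomb r y B.
  rewrite /lincomb !mulr_suml -big_split /=; apply: eq_bigr => i _.
  rewrite !mulr_sumr -big_split /=; apply: eq_bigr => j _.
  by rewrite /psi; ring.
have Equad (A B : 'rV[R]_n) : (A *m G *m B^T) 0 0 =
    E (fun y => lincomb p y A * lincomb p y B + lincomb r y A * lincomb r y B).
  rewrite quad; have cs i : cont_on Omega (fun y => \sum_j A 0 i * B 0 j * psi p r i j y).
    by apply: cont_on_sum => j; apply: cont_onM; [exact: cont_on_cst|exact: cpsi].
  have := expect_sum hE (index_enum 'I_n) cs => /= h.
  transitivity (E (fun y => \sum_i \sum_j A 0 i * B 0 j * psi p r i j y)).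
    rewrite h; apply: eq_bigr => i _.
    have cs' j : cont_on Omega (fun y => A 0 i * B 0 j * psi p r i j y).
      by apply: cont_onM; [exact: cont_on_cst|exact: cpsi].
    rewrite (expect_sum hE (index_enum 'I_n) cs') /=; apply: eq_bigr => j _.
    by rewrite (expectZ hE).
  by congr (fine _); apply: eq_integral => y _; rewrite lin2.
have modE c : E (fun y => modV p r y c ^+ 2) = (c *m G *m c^T) 0 0.
  by rewrite Equad; congr (fine _); apply: eq_integral => y _; rewrite /modV hypot_sqr !expr2.
have Gs : G^T = G.
  apply/matrixP => i j; rewrite !mxE; congr (fine _); apply: eq_integral => y _.
  by rewrite /psi mulrC [X in _ + X]mulrC.
have Gp (v : 'rV[R]_n) : v != 0 -> 0 < (v *m G *m v^T) 0 0.
  move=> v0; rewrite ltNge; apply: contra v0 => le0; apply/eqP/def => x Ox; apply/eqP.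
  rewrite eq_le hypot_ge0 andbT.
  apply: le_trans (nik v x Ox) _; rewrite modE ler0_sqrtr //.
  by rewrite mulr0.
have [A Au hA] := gram_orthonormal Gs Gp.
pose p' i y := lincomb p y (row i A); pose r' i y := lincomb r y (row i A).
have lc (u : 'I_n -> 'rV[R]_d -> R) y c :
    lincomb (fun i y => lincomb u y (row i A)) y c = lincomb u y (c *m A).
  rewrite /lincomb; under eq_bigr do rewrite mulr_sumr.
  rewrite exchange_big; apply: eq_bigr => j _; rewrite mxE mulr_suml.
  by apply: eq_bigr => i _; rewrite mxE mulrA.
have modA y c : modV p' r' y c = modV p r y (c *m A) by rewrite /modV !lc.
exists p', r'; split.
- by move=> i; exact: cont_on_lincomb.
- by move=> i; exact: cont_on_lincomb.
- move=> i j; rewrite -Equad.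
  have -> : (row i A *m G *m (row j A)^T) 0 0 = (A *m G *m A^T) i j.
    by rewrite -row_mul !mxE; apply: eq_bigr => k _; rewrite !mxE.
  by rewrite hA mxE.
- move=> c x Ox; rewrite modA; apply: le_trans (nik _ x Ox) _.
  by under eq_Rintegral do rewrite -modA.
- by move=> c; exists (c *m invmx A) => x; rewrite modA mulmxKV.
Qed.

End Orthonormalize.

(** * Luxemburg norms and the discretization theorem *)

(** Checks the hypotheses of orlicz_sampling for the coefficients of functions with
    mean of Phi at most 1. For fixed x, the Nikolskii inequality for the
    coefficients (p_i(x))_i bounds the sum of the p_i(x)^2 by H^2, likewise for r;
    integrating the two sums gives n <= 2 H^2. The mean of |f|^2 is at most
    H |f|_2 times the mean of |f|, which is at most K; hence |f|_2 <= H K. *)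
Lemma model_sampling {R : realType} (Phi : R -> R) (q : nat) (a : R) :
  regular_growth Phi q a ->
  exists2 C : R, 0 < C &
  forall (d : nat) (Omega : set 'rV[R]_d), compact Omega ->
  forall mu : probability (borel_space R d) R, mu Omega = 1%E ->
  forall (N n : nat) (H : R), (0 < N)%N -> (0 < n)%N -> (n <= 2 * N)%N -> 1 <= H ->
  forall p r : 'I_n -> 'rV[R]_d -> R,
  (forall i, cont_on Omega (p i)) -> (forall i, cont_on Omega (r i)) ->
  (forall i j, \int[mu]_(y in Omega) (p i y * p j y + r i y * r j y) = (i == j)%:R) ->
  nikolskii_model Omega mu H p r ->
  forall eps : R, 0 < eps -> eps <= 1 / 2 ->
  exists (m : nat) (x : nat -> 'rV[R]_d),
    [/\ (0 < m)%N, forall j, (j < m)%N -> Omega (x j),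
        m%:R <= C * eps ^- 2 * log2 (eps^-1) * Phi (H ^+ 2)
                  * log2 (2 * N%:R) ^+ 2 * log2 (2 * H ^+ 2)
      & forall c, \int[mu]_(y in Omega) Phi (modV p r y c) <= 1 ->
         `|avg m x (fun y => Phi (modV p r y c)) -
           \int[mu]_(y in Omega) Phi (modV p r y c)| <= eps].
Proof.
move=> hP; have a1 := growth_a1 hP.
have phi1 := growth_gt0 hP ltr01.
pose K := 1 + 2 * (a / Phi 1).
have aP0 : 0 <= a / Phi 1 by rewrite divr_ge0 ?(ltW phi1) //; lra.
have K1 : 1 <= K by rewrite /K; lra.
have K0 : 0 < K by lra.
have w0 : 0 <= q%:R * a * K ^+ q.
  by rewrite !mulr_ge0 ?exprn_ge0 ?(ltW K0) //; lra.
have [C C0 hC] := sample_size_bound q (ler0n R 512) (ler0n R 2048) (ler0n R 4108) w0 phi1.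
exists C => // d Omega cO mu muO N n H N0 n0 nN H1 p r cp cr on nik eps e0 e1.
have hE := integral_expectation cO muO.
have H0 : 0 < H by lra.
have HH : 1 <= H ^+ 2 by exact: exprn_ege1.
have mge0 x c : 0 <= modV p r x c by exact: hypot_ge0.
pose psi (ij : 'I_n * 'I_n) y := p ij.1 y * p ij.2 y + r ij.1 y * r ij.2 y.
have cpsi ij : cont_on Omega (psi ij) by apply: cont_onD; exact: cont_onM.
have Epsi i j : \int[mu]_(y in Omega) psi (i, j) y = (i == j)%:R by exact: on.
have clsPhi c : cont_on Omega (fun y => Phi (modV p r y c)) by exact: (cont_on_growth hP).
have cV c : cont_on Omega (fun y => modV p r y c) by exact: cont_on_modV.
have cV2 c : cont_on Omega (fun y => modV p r y c ^+ 2).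
  by under eq_fun do rewrite expr2; exact: cont_onM.
have l2 c : \int[mu]_(y in Omega) modV p r y c ^+ 2 = \sum_i c 0 i ^+ 2.
  under eq_Rintegral do rewrite modV_sqr.
  have cs i j : cont_on Omega (fun y => c 0 i * c 0 j * psi (i, j) y).
    by apply: cont_onM; [exact: cont_on_cst|exact: cpsi].
  have cs' i : cont_on Omega (fun y => \sum_j c 0 i * c 0 j * psi (i, j) y).
    by apply: cont_on_sum => j; exact: cs.
  rewrite (expect_sum hE (index_enum 'I_n) cs') /=; apply: eq_bigr => i _.
  rewrite (expect_sum hE (index_enum 'I_n) (cs i)) /= (bigD1 i) //=.
  rewrite (expectZ hE) // Epsi eqxx mulr1 big1 ?addr0 ?expr2 // => j ji.
  by rewrite (expectZ hE) // Epsi eq_sym (negbTE ji) mulr0.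
have nik' c x : Omega x -> modV p r x c <= H * Num.sqrt (\sum_i c 0 i ^+ 2).
  by move=> Ox; rewrite -l2; exact: nik.
have christoffel (u : 'I_n -> 'rV[R]_d -> R) x : Omega x ->
    (forall c, `|lincomb u x c| <= modV p r x c) -> \sum_i u i x ^+ 2 <= H ^+ 2.
  move=> Ox hu; set s := \sum_i _.
  have s0 : 0 <= s by apply: sumr_ge0 => i _; exact: sqr_ge0.
  have h1 : s <= H * Num.sqrt s.
    have e (c : 'rV[R]_n) : c = \row_i u i x -> lincomb u x c = s /\ \sum_i c 0 i ^+ 2 = s.
      move=> ->; split; apply: eq_bigr => i _; rewrite mxE ?expr2 //.
    have [e3 e4] := e _ erefl.
    have := le_trans (hu _) (nik' (\row_i u i x) x Ox); rewrite e3 e4.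
    exact: le_trans (ler_norm _).
  have q0 : 0 <= Num.sqrt s by exact: sqrtr_ge0.
  have q2 : Num.sqrt s ^+ 2 = s by rewrite sqr_sqrtr.
  have [qz|qnz] := eqVneq (Num.sqrt s) 0.
    by rewrite -q2 qz expr0n; exact: sqr_ge0.
  have qp : 0 < Num.sqrt s by rewrite lt_def qnz.
  rewrite -q2 lerXn2r ?nnegrE ?(ltW H0) //.
  by rewrite -(ler_pM2r qp) -expr2 q2.
have hp x : Omega x -> \sum_i p i x ^+ 2 <= H ^+ 2.
  move=> Ox; apply: christoffel => // c.
  by rewrite -hypot0 hypot_le ?hypot_ge0 // /modV hypot_sqr lerD2l expr0n sqr_ge0.
have hr x : Omega x -> \sum_i r i x ^+ 2 <= H ^+ 2.
  move=> Ox; apply: christoffel => // c.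
  by rewrite -hypot0 hypot_le ?hypot_ge0 // /modV hypot_sqr expr0n addr0 lerDr sqr_ge0.
have nH : n%:R <= 2 * H ^+ 2.
  have cs i : cont_on Omega (psi (i, i)) by exact: cpsi.
  have := expect_sum hE (index_enum 'I_n) cs => /= h.
  have -> : n%:R = \int[mu]_(x in Omega) \sum_i psi (i, i) x.
    rewrite h; under eq_bigr do rewrite Epsi eqxx.
    by rewrite sumr_const card_ord.
  rewrite -[leRHS](expect_cst hE); apply: (expect_le hE).
  - exact: cont_on_sum.
  - exact: cont_on_cst.
  - move=> x Ox; have := hp x Ox; have := hr x Ox.
    rewrite /psi big_split /=; under [X in X + _]eq_bigr do rewrite -expr2.
    by under [X in _ + X]eq_bigr do rewrite -expr2; lra.
pose F : set 'rV[R]_n := [set c | \int[mu]_(y in Omega) Phi (modV p r y c) <= 1].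
have F0 : F 0.
  rewrite /F /=; under eq_Rintegral do rewrite (modulus0 (modV_modulus p r)) (growth_at0 hP).
  by rewrite (expect_cst hE).
have FE c : F c -> \int[mu]_(y in Omega) Phi (modV p r y c) <= 1 by [].
have FV c : F c -> \int[mu]_(y in Omega) modV p r y c <= K.
  move=> Fc; apply: (@le_trans _ _ (\int[mu]_(y in Omega) (1 + a / Phi 1 * Phi (modV p r y c)))).
    apply: (expect_le hE) => //.
      by apply: cont_onD; [exact: cont_on_cst|apply: cont_onM => //; exact: cont_on_cst].
    by move=> y _; exact: (growth_ge_linear hP).
  have cP : cont_on Omega (fun y => a / Phi 1 * Phi (modV p r y c)).
    by apply: cont_onM => //; exact: cont_on_cst.
  rewrite (expectD hE) //; last exact: cont_on_cst.
  rewrite (expectZ hE) // (expect_cst hE) /K lerD2l.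
  have : a / Phi 1 * (\int[mu]_(y in Omega) Phi (modV p r y c)) <= a / Phi 1 * 1.
    by rewrite ler_wpM2l //; exact: FE.
  lra.
have Fs c : F c -> Num.sqrt (\sum_i c 0 i ^+ 2) <= H * K.
  move=> Fc; set s := \sum_i _.
  have s0 : 0 <= s by apply: sumr_ge0 => i _; exact: sqr_ge0.
  have q0 : 0 <= Num.sqrt s by exact: sqrtr_ge0.
  have q2 : Num.sqrt s ^+ 2 = s by rewrite sqr_sqrtr.
  have h : s <= H * Num.sqrt s * K.
    apply: (@le_trans _ _ (\int[mu]_(y in Omega) modV p r y c ^+ 2)); first by rewrite l2.
    apply: (@le_trans _ _ (\int[mu]_(y in Omega) (H * Num.sqrt s * modV p r y c))).
      apply: (expect_le hE) => //.
        by apply: cont_onM => //; exact: cont_on_cst.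
      by move=> y Oy; rewrite expr2 ler_wpM2r //; exact: nik'.
    rewrite (expectZ hE) //; apply: ler_wpM2l; last exact: FV.
    by rewrite mulr_ge0 // ltW.
  have [->|qnz] := eqVneq (Num.sqrt s) 0; first by rewrite mulr_ge0 // ltW.
  have qp : 0 < Num.sqrt s by rewrite lt_def qnz.
  by rewrite -(ler_pM2r qp) -expr2 q2 mulrAC.
have F2 c : F c -> \sum_i c 0 i ^+ 2 <= (H * K) ^+ 2.
  move=> Fc; have s0 : 0 <= \sum_i c 0 i ^+ 2 by apply: sumr_ge0 => i _; exact: sqr_ge0.
  rewrite -(sqr_sqrtr s0) lerXn2r ?nnegrE ?sqrtr_ge0 ?Fs //.
  by rewrite mulr_ge0 // ltW.
have FB c : F c -> forall y, Omega y -> modV p r y c <= H ^+ 2 * K.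
  move=> Fc y Oy; apply: le_trans (nik' c y Oy) _.
  by rewrite expr2 -mulrA ler_wpM2l ?(ltW H0) //; exact: Fs.
have [J [J0 nJ hJ]] := @dyadic_depth R n n0.
have [m [x [m0 hm xO hx]]] := orlicz_sampling hE hP n0 H1 e0 e1 clsPhi cpsi Epsi hp hr
  F0 FE F2 FB J0 nJ.
exists m, x; split => //.
apply: le_trans hm _.
have B0 : 0 < H ^+ 2 * K by rewrite mulr_gt0 // exprn_gt0.
have LBE : @growth_lip R Phi q a (H ^+ 2 * K) * (H ^+ 2 * K) = q%:R * a * Phi (H ^+ 2 * K).
  by rewrite /growth_lip -mulrA divfK // gt_eqF.
have e4 : H ^+ 4 = (H ^+ 2) ^+ 2 by ring.
rewrite e4.
apply: (hC n N J (H ^+ 2) eps _ (Phi (H ^+ 2)) _ _) => //.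
- by rewrite -natrM ler_nat.
- by rewrite mulr_ge0 ?(ltW B0) // ltW // (growth_lip_gt0 hP).
- rewrite LBE -[leRHS]mulrA ler_wpM2l ?mulr_ge0 //; first by lra.
  by rewrite mulrC; apply: (growth_dilate hP) => //; rewrite exprn_gt0.
- exact: (growth_mono hP).
- by have := growth_dilate hP HH ltr01; rewrite mulr1 mulrC.
Qed.

(** I l and J l stand for the means of Phi(|f| / l) for the two measures. If
    I l <= 1 then J l <= 1 + eps, and replacing l by a (1 + eps) l brings J below 1.
    Conversely I exceeds 1 just below nI and, by (Dec), is still close to 1 just
    above nI; there J is at least about 1 - eps, while J l <= a l' / l for every l' <= l
    with J l' <= 1. *)
Lemma luxemburg_compare {R : realType} (I J : R -> R) (a eps : R) (q : nat) :
  1 <= a -> 0 < eps -> eps <= 1 / 2 ->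
  (forall l, 0 < l -> 0 <= I l) -> (forall l, 0 < l -> 0 <= J l) ->
  (forall l k, 0 < l -> 1 <= k -> I (k * l) <= a / k * I l) ->
  (forall l k, 0 < l -> 1 <= k -> J (k * l) <= a / k * J l) ->
  (forall l k, 0 < l -> 1 <= k -> I (k * l) <= I l) ->
  (forall l k, 0 < l -> 1 <= k -> I l <= k ^+ q * I (k * l)) ->
  (forall l, 0 < l -> I l <= 1 -> `|J l - I l| <= eps) ->
  let nI := inf [set l | 0 < l /\ I l <= 1] in
  let nJ := inf [set l | 0 < l /\ J l <= 1] in
  a ^- 2 * (1 - eps) * nI <= nJ /\ nJ <= a ^+ 2 * (1 + eps) * nI.
Proof.
move=> a1 e0 e1 I0 J0 Isc Jsc Imon Iq close nI nJ.
have a0 : 0 < a by lra.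
set SI := [set l | _] in nI *; set SJ := [set l | _] in nJ *.
have lbI : has_lbound SI by exists 0 => l [/ltW].
have lbJ : has_lbound SJ by exists 0 => l [/ltW].
have SI0 : SI !=set0.
  have i1 := I0 1 ltr01; have ai : 0 <= a * I 1 by rewrite mulr_ge0 // ltW.
  have k1 : 1 <= 1 + a * I 1 by lra.
  exists ((1 + a * I 1) * 1); split; first by rewrite mulr1; lra.
  apply: le_trans (Isc 1 _ ltr01 k1) _.
  by rewrite mulrAC ler_pdivrMr ?mul1r; lra.
have up l : SI l -> SJ (a * (1 + eps) * l).
  move=> [l0 Il]; have k1 : 1 <= a * (1 + eps) by nra.
  split; first by rewrite mulr_gt0 //; lra.
  apply: le_trans (Jsc l _ l0 k1) _.
  have : J l <= 1 + eps by have := close l l0 Il; rewrite ler_norml => /andP[_]; lra.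
  move=> Jl; rewrite mulrAC ler_pdivrMr ?mul1r; last by lra.
  by rewrite ler_pM2l.
have SJ0 : SJ !=set0 by case: SI0 => l /up h; exists (a * (1 + eps) * l).
have nI0 : 0 <= nI by apply: lb_le_inf => // l [/ltW].
have nJ0 : 0 <= nJ by apply: lb_le_inf => // l [/ltW].
have ae0 : 0 < a * (1 + eps) by rewrite mulr_gt0 //; lra.
split; last first.
  apply: (@le_trans _ _ (a * (1 + eps) * nI)).
    rewrite -ler_pdivrMl //; apply: lb_le_inf => // l Sl.
    by rewrite ler_pdivrMl //; apply: ge_inf => //; exact: up.
  rewrite expr2 -!mulrA ler_pM2l //; rewrite ler_peMl // mulr_ge0 //; lra.
apply: (@le_trans _ _ ((1 - eps) * nI / a)).
  have -> : a ^- 2 * (1 - eps) * nI = (1 - eps) * nI / a * a^-1 by field; rewrite gt_eqF.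
  rewrite ler_piMr ?invf_le1 // divr_ge0 ?(ltW a0) // mulr_ge0 //; lra.
have [nIz|nInz] := eqVneq nI 0; first by rewrite nIz mulr0 mul0r.
have nIp : 0 < nI by rewrite lt_def nInz.
apply: lb_le_inf => // l' [l'0 Jl'].
rewrite leNgt; apply/negP; rewrite ltr_pdivlMr // => hlt.
(* The window from (1 - t) nI to (1 + t) nI is so narrow that I loses less than
   the gap across it: the loss is at most 2 q t. *)
pose gap := (1 - eps) - l' * a / nI.
have gap0 : 0 < gap by rewrite /gap subr_gt0 ltr_pdivrMr.
have l'n : l' < nI by nra.
pose t := gap / (4 * q%:R + 4).
have q0 : 0 <= q%:R :> R by [].
have t0 : 0 < t by rewrite divr_gt0 //; lra.
have gap1 : gap <= 1.
  have : 0 <= l' * a / nI by rewrite divr_ge0 ?mulr_ge0 ?ltW.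
  by rewrite /gap; lra.
have t1 : t <= 1 / 4.
  by rewrite /t ler_pdivrMr; lra.
have tq : 2 * q%:R * t < gap.
  rewrite /t mulrA ltr_pdivrMr; last by lra.
  by nra.
pose l := (1 + t) * nI; pose l2 := (1 - t) * nI.
have l0 : 0 < l by rewrite mulr_gt0 //; lra.
have l20 : 0 < l2 by rewrite mulr_gt0 //; lra.
have ln : nI < l by rewrite /l ltr_pMl //; lra.
have Il : I l <= 1.
  have [s [s0 Is] sl] : exists2 s, SI s & s < l.
    have h := @inf_adherent R SI (l - nI); have [||s Ss hs] := h.
    - by rewrite subr_gt0.
    - by split.
    - by exists s => //; move: hs; rewrite -/nI; lra.
  have k1 : 1 <= l / s by rewrite ler_pdivlMr // mul1r ltW.
  by have := Imon s _ s0 k1; rewrite divfK ?gt_eqF // => h; exact: le_trans h Is.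
have Il2 : 1 < I l2.
  rewrite ltNge; apply/negP => h; have : nI <= l2 by apply: ge_inf.
  by rewrite /l2 mulrBl mul1r; have := mulr_gt0 t0 nIp; lra.
have k2 : 1 <= l / l2.
  by rewrite ler_pdivlMr // mul1r /l /l2 ler_pM2r //; lra.
have h1 := Iq l2 _ l20 k2; rewrite divfK ?gt_eqF // in h1.
have k3 : 1 <= l / l' by rewrite ler_pdivlMr // mul1r ltW // (lt_trans l'n).
have h2 := Jsc l' _ l'0 k3; rewrite divfK ?gt_eqF // in h2.
have h3 : J l <= a * l' / nI.
  apply: le_trans h2 _; apply: (@le_trans _ _ (a / (l / l') * 1)).
    by rewrite ler_wpM2l // divr_ge0 ?divr_ge0 // ltW.
  rewrite mulr1 invf_div mulrA ler_pM2l ?mulr_gt0 // lef_pV2 ?posrE // ltW //.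
have x0 : 0 <= l2 / l by rewrite divr_ge0 // ltW.
have x1 : l2 / l <= 1 by rewrite ler_pdivrMr // mul1r /l2 /l ler_pM2r //; lra.
have hb := bernoulli_sub q x0 x1.
have hx : 1 - l2 / l <= 2 * t.
  have -> : l2 / l = (1 - t) / (1 + t).
    by rewrite /l /l2; field; rewrite !gt_eqF //; lra.
  have tp : 0 < 1 + t by lra.
  have -> : 1 - (1 - t) / (1 + t) = 2 * t / (1 + t) by field; rewrite gt_eqF.
  by rewrite ler_pdivrMr // ler_peMr //; lra.
have h4 : (l2 / l) ^+ q <= I l.
  have e : (l / l2) ^+ q * (l2 / l) ^+ q = 1.
    by rewrite -exprMn mulrA divfK ?gt_eqF // divff ?expr1n // gt_eqF.
  have kp : 0 < (l / l2) ^+ q by rewrite exprn_gt0 // divr_gt0.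
  by rewrite -(ler_pM2l kp) e; lra.
have h5 := close l l0 Il; rewrite ler_norml in h5; case/andP: h5 => h5 _.
have h6 : q%:R * (1 - l2 / l) <= q%:R * (2 * t) by rewrite ler_wpM2l.
have e7 : a * l' / nI = l' * a / nI by rewrite [a * l']mulrC.
move: h3 h4 h5 h6 hb tq; rewrite e7 /gap; lra.
Qed.

Section ExpectScale.
Context {R : realType} {T : Type} {D : set T} {cls : set (T -> R)}
  {E : (T -> R) -> R} (hE : expectation D cls E).
Context (n : nat) (p r : 'I_n -> T -> R).
Context (Phi : R -> R) (q : nat) (a : R) (hP : regular_growth Phi q a).
Hypothesis cPhi : forall c, cls (fun y => Phi (modV p r y c)).

Lemma modVZ y k c : 0 <= k -> modV p r y (k *: c) = k * modV p r y c.
Proof.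
move=> k0; rewrite /modV.
have e u : lincomb u y (k *: c) = k * lincomb u y c.
  by rewrite /lincomb mulr_sumr; apply: eq_bigr => i _; rewrite mxE mulrA.
by rewrite !e /hypot !exprMn -mulrDr sqrtrM ?sqr_ge0 // sqrtr_sqr ger0_norm.
Qed.

Lemma expect_growth_ge0 c : 0 <= E (fun y => Phi (modV p r y c)).
Proof.
rewrite -(expect_cst hE 0); apply: (expect_le hE) => //; first exact: cls_cst hE _.
by move=> y _; rewrite (growth_ge0 hP) // hypot_ge0.
Qed.

Lemma expect_growth_scale c k l : 0 < l -> 1 <= k ->
  [/\ E (fun y => Phi (modV p r y ((k * l)^-1 *: c))) <=
        a / k * E (fun y => Phi (modV p r y (l^-1 *: c))),
      E (fun y => Phi (modV p r y ((k * l)^-1 *: c))) <=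
        E (fun y => Phi (modV p r y (l^-1 *: c))) &
      E (fun y => Phi (modV p r y (l^-1 *: c))) <=
        k ^+ q * E (fun y => Phi (modV p r y ((k * l)^-1 *: c)))].
Proof.
move=> l0 k1; have k0 : 0 < k by lra.
have ki0 : 0 < k^-1 by rewrite invr_gt0.
have ki1 : k^-1 <= 1 by rewrite invf_le1.
have e y : modV p r y ((k * l)^-1 *: c) = k^-1 * modV p r y (l^-1 *: c).
  by rewrite invfM -scalerA modVZ // ltW.
have m0 y : 0 <= modV p r y (l^-1 *: c) by exact: hypot_ge0.
split.
- rewrite -(expectZ hE) //; apply: (expect_le hE) => //; first exact: (clsZ hE).
  by move=> y _; rewrite e; exact: (growth_shrink hP).
- apply: (expect_le hE) => // y _; rewrite e; apply: (growth_mono hP).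
    by rewrite mulr_ge0 // ltW.
  by rewrite ler_piMl.
- rewrite -(expectZ hE) //; apply: (expect_le hE) => //; first exact: (clsZ hE).
  move=> y _; rewrite e; have := growth_shrink_ge hP ki0 ki1 (m0 y).
  by rewrite exprVn ler_pdivrMl // exprn_gt0.
Qed.

End ExpectScale.

Theorem theorem3p2 (R : realType) (Phi : R -> R)
    (hPhi : Phi_function Phi) (hDec : Phi_Dec Phi) :
  exists C : R, 0 < C /\
  forall (a : R), almost_increasing_const Phi a ->
  forall (K : numFieldType) (nrm : K -> R), scalar_field nrm ->
  forall (d : nat) (Omega : set 'rV[R]_d), compact Omega ->
  forall mu : probability (borel_space R d) R, mu Omega = 1%E ->
  forall (N : nat) (H : R), (1 <= N)%N -> 1 <= H ->
  forall X : set ('rV[R]_d -> K), subspace_of_C Omega N X ->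
    nikolskii_2oo nrm Omega mu X H ->
  forall eps : R, 0 < eps -> eps <= 1 / 2 ->
  exists (m : nat) (x : nat -> 'rV[R]_d),
    [/\ (0 < m)%N,
        forall j, (j < m)%N -> Omega (x j),
        m%:R <= C * eps ^- 2 * log2 (eps^-1) * Phi (H ^+ 2)
                  * log2 (2 * N%:R) ^+ 2 * log2 (2 * H ^+ 2)
      & forall f, X f ->
          let normPhi := luxemburg_norm Phi mu Omega (fun y => nrm (f y)) in
          let normPhix := luxemburg_norm Phi (empirical_measure m x) Omega
                            (fun y => nrm (f y)) in
          a ^- 2 * (1 - eps) * normPhi <= normPhix /\
          normPhix <= a ^+ 2 * (1 + eps) * normPhi].
Proof.
have [a0 ha0] := Phi_almost_increasing hPhi.
have [q0 hP0] := regular_growth_of_Dec hPhi hDec ha0.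
have [C C0 hC] := model_sampling hP0.
exists C; split=> // a ha K nrm hnrm d Omega cO mu muO N H N0 H1 X hX nik eps e0 e1.
have [q hP] := regular_growth_of_Dec hPhi hDec ha.
have [n [p [r [nN n0 [cp cr modelX Xmodel def]]]]] : exists (n : nat) p r,
    [/\ (n <= 2 * N)%N, (0 < n)%N & real_model nrm Omega X (n := n) p r].
  case: hnrm X hX nik => X hX _.
    have [p [r hpr]] := real_model_real hX.
    by exists N, p, r; split => //; rewrite leq_pmull.
  have [p [r hpr]] := real_model_complex hX.
  by exists (N + N)%N, p, r; split => //; rewrite ?mul2n ?addnn ?double_gt0.
have nikm : nikolskii_model Omega mu H p r.
  move=> c x Ox; have [f Xf hf] := Xmodel c.
  rewrite -hf //; apply: le_trans (nik f Xf x Ox) _.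
  have -> // : \int[mu]_(y in Omega) nrm (f y) ^+ 2 = \int[mu]_(y in Omega) modV p r y c ^+ 2.
  by apply: eq_Rintegral => y /set_mem Oy; rewrite hf.
have [p' [r' [cp' cr' on nik' chg]]] := orthonormal_model cO muO cp cr def nikm.
have [m [x [m0 xO hm hx]]] :=
  hC d Omega cO mu muO N n H N0 n0 nN H1 p' r' cp' cr' on nik' eps e0 e1.
exists m, x; split => // f Xf.
have [c0 hc0] := modelX f Xf; have [c hc] := chg c0.
have hf y : Omega y -> nrm (f y) = modV p' r' y c by move=> Oy; rewrite hc0 // hc.
have hE := integral_expectation cO muO.
have hA := @avg_expectation R _ m x m0.
have cPhi c' : cont_on Omega (fun y => Phi (modV p' r' y c')) by exact: (cont_on_growth hP).
have scaled l y : 0 < l -> Omega y -> nrm (f y) / l = modV p' r' y (l^-1 *: c).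
  by move=> l0 Oy; rewrite modVZ ?invr_ge0 ?(ltW l0) // hf // mulrC.
pose normE l := \int[mu]_(y in Omega) Phi (modV p' r' y (l^-1 *: c)).
pose normA l := avg m x (fun y => Phi (modV p' r' y (l^-1 *: c))).
have normI : luxemburg_norm Phi mu Omega (fun y => nrm (f y)) =
    inf [set l | 0 < l /\ normE l <= 1].
  congr inf; apply/seteqP; split => l [l0 hl]; split => //.
    move: hl; rewrite -lee_fin -integral_cont_on //.
    apply: le_trans; rewrite le_eqVlt; apply/orP; left; apply/eqP.
    by apply: eq_integral => y /set_mem Oy; rewrite scaled.
  move: hl; rewrite -lee_fin -integral_cont_on //.
  apply: le_trans; rewrite le_eqVlt; apply/orP; left; apply/eqP.
  by apply: eq_integral => y /set_mem Oy; rewrite scaled.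
have normJ : luxemburg_norm Phi (empirical_measure m x) Omega (fun y => nrm (f y)) =
    inf [set l | 0 < l /\ normA l <= 1].
  have emp l : 0 < l -> (\int[empirical_measure m x]_(y in Omega) (Phi (nrm (f y) / l))%:E)%E
      = (normA l)%:E.
    move=> l0; rewrite /normA -(@integral_empirical R d Omega cO m x) //.
      by apply: eq_integral => y /set_mem Oy; rewrite scaled.
    by move=> y Oy; rewrite (growth_ge0 hP) // hypot_ge0.
  congr inf; apply/seteqP; split => l [l0 hl]; split => //.
    by rewrite -lee_fin -emp.
  by rewrite emp // lee_fin.
have cA c' : [set: 'rV[R]_d -> R] (fun y => Phi (modV p' r' y c')) by [].
have avg0 := expect_growth_ge0 hA hP cA.
rewrite normI normJ; apply: (@luxemburg_compare R normE normA a eps q) => //.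
- exact: (growth_a1 hP).
- by move=> l l0; exact: (expect_growth_ge0 hE hP cPhi).
- by move=> l l0; exact: avg0.
- by move=> l k l0 k1; have [] := expect_growth_scale hE hP cPhi c l0 k1.
- by move=> l k l0 k1; have [] := expect_growth_scale hA hP cA c l0 k1.
- by move=> l k l0 k1; have [] := expect_growth_scale hE hP cPhi c l0 k1.
- by move=> l k l0 k1; have [] := expect_growth_scale hE hP cPhi c l0 k1.
- by move=> l l0; exact: hx.
Qed.
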